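(* Let $\Delta\ge3$ be a constant. For all $n\ge1$, there exists a bipartite graph $G=(L,R,E)$ with $|L|=|R|=n$ and maximum degree at most $\Delta$ such that the Gibbs distribution $\mu$ of the antiferromagnetic Ising model on $G$ with zero external field and inverse temperature $\beta=-\beta_c(\Delta)=-\frac12\log\frac{\Delta}{\Delta-2}$ satisfies $$\lambda_{\max}(\Psi_\mu)\ge\frac{\mathbf s^\intercal\Psi_\mu\mathbf s}{\mathbf s^\intercal\mathbf s}=\frac{\mathbf s^\intercal\Psi_\mu\mathbf s}{2n}=\Omega(\sqrt n),$$ where $\mathbf s\in\mathbb{R}^{L\cup R}$ has $\mathbf s_u=1$ for $u\in L$ and $\mathbf s_u=-1$ for $u\in R$.
   Context: The Ising Gibbs distribution on $G$ with adjacency matrix $A_G$, inverse temperature $\beta$ and zero field is $\mu(\mathbf x)\propto\exp\left(\frac\beta2\mathbf x^\intercal A_G\mathbf x\right)$ on $\{-1,+1\}^{L\cup R}$. For $X\sim\mu$, the influence matrix is $\Psi_\mu(i,j)=\Pr[X_j=+1\mid X_i=+1]-\Pr[X_j=+1\mid X_i=-1]$ if $\mathbb{E}[X_i]\in(-1,1)$ and $0$ otherwise. The implicit constant in $\Omega$ depends only on $\Delta$. *)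

(* Defs.v *)
From mathcomp Require Import all_boot all_order all_algebra.
From mathcomp Require Import boolp classical_sets reals sequences exp.

Set Implicit Arguments.
Unset Strict Implicit.
Unset Printing Implicit Defensive.

Import Order.TTheory GRing.Theory Num.Theory.
Local Open Scope ring_scope.

Definition simple_graph (V : finType) (e : rel V) : Prop :=
  symmetric e /\ irreflexive e.

Definition bipartition (V : finType) (A B : {set V}) (e : rel V) : Prop :=
  [/\ [disjoint A & B],
      forall v : V, v \in A \/ v \in B
    & forall u v : V, e u v ->
        (u \in A /\ v \in B) \/ (u \in B /\ v \in A)].

Definition max_degree (V : finType) (e : rel V) : nat :=
  \max_(v : V) #|[pred w : V | e v w]|.

Definition adjacency_mx (R : realType) (N : nat) (e : rel 'I_N) : 'M[R]_N :=
  \matrix_(i, j) (e i j)%:R.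

(* A configuration in {-1,+1}^N is encoded by booleans, [true] being spin +1. *)
Definition config (N : nat) := {ffun 'I_N -> bool}.

Definition spin (R : realType) (b : bool) : R := if b then 1 else -1.

Definition spin_vec (R : realType) (N : nat) (x : config N) : 'cV[R]_N :=
  \col_i spin R (x i).

Definition qform (R : realType) (N : nat) (M : 'M[R]_N) (v : 'cV[R]_N) : R :=
  (v^T *m M *m v) 0 0.

Definition ising_weight (R : realType) (N : nat) (e : rel 'I_N) (beta : R)
    (x : config N) : R :=
  expR (beta / 2 * qform (adjacency_mx R e) (spin_vec R x)).

Definition partition_function (R : realType) (N : nat) (e : rel 'I_N)
    (beta : R) : R :=
  \sum_(x : config N) ising_weight e beta x.

Definition ising_gibbs (R : realType) (N : nat) (e : rel 'I_N) (beta : R)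
    (x : config N) : R :=
  ising_weight e beta x / partition_function e beta.

Section Distribution.
Variables (R : realType) (N : nat) (mu : config N -> R).

Definition prob (P : pred (config N)) : R := \sum_(x | P x) mu x.

Definition cond_prob (P Q : pred (config N)) : R :=
  prob (predI P Q) / prob Q.

Definition mean_spin (i : 'I_N) : R := \sum_x mu x * spin R (x i).

Definition influence_mx : 'M[R]_N :=
  \matrix_(i, j)
    if -1 < mean_spin i < 1 then
      cond_prob (fun x => x j == true) (fun x => x i == true)
      - cond_prob (fun x => x j == true) (fun x => x i == false)
    else 0.

End Distribution.

(* The largest real eigenvalue. For N > 0 the influence matrix of a probability
   distribution is similar to a symmetric
   matrix, so its spectrum is real and nonempty, and this supremum is
   attained. *)
Definition lambda_max (R : realType) (N : nat) (M : 'M[R]_N) : R :=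
  sup [set a : R | eigenvalue M a]%classic.

Definition beta_c (R : realType) (Delta : nat) : R :=
  ln (Delta%:R / (Delta%:R - 2)) / 2.

Definition side_vec (R : realType) (N : nat) (A : {set 'I_N}) : 'cV[R]_N :=
  \col_u if u \in A then 1 else -1.

(* Main.v *)
(**
  Flipping the spins of [R] turns the model into a ferromagnet in which every
  edge with disagreeing ends costs a factor [q = (Delta - 2) / Delta], and turns
  the quadratic form into the second moment of the total magnetization.

  The graph is found by a first moment argument: it is a union of [Delta]
  independent uniform perfect matchings, weighted by its own partition function.
  Under the resulting annealed measure the weight of a configuration depends
  only on the numbers [k], [l] of plus spins on the two sides, and for one
  matching it is a sum over the number [a] of plus-plus edges of explicit
  products of factorials.  Moving [(k, l, a)] by [(t, t, t)] changes no
  disagreeing edge; the second-order terms of the factorials cancel exactly at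
  [beta_c], so for [t] of order [n^(3/4)] the weight at one of [(k + t, l + t)],
  [(k - t, l - t)] is at least a constant times the weight at [(k, l)].  Hence
  the magnetization is spread over the scale [n^(3/4)].  The comparison needs
  [k - l = O(n^(3/4))], which comes from Griffiths' inequality (the difference
  of the two magnetizations has a smaller second moment than their sum), and a
  number of disagreeing edges within [O(sqrt n)] of its typical value, which
  comes from an exact second moment identity for [a].

  Double edges: given the spins, their expected number is bounded uniformly in
  [n], so some multigraph has boundedly many of them and a large magnetization,
  and removing the repetitions changes weights by a bounded factor.
*)
Require Import Defs.
From mathcomp Require Import all_boot all_order all_algebra.
From mathcomp Require Import boolp classical_sets reals sequences exp.
From mathcomp Require Import topology normedtype derive realfun.
From mathcomp Require Import complex spectral.
From mathcomp Require Import finset perm fingroup.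
From mathcomp Require Import ring lra zify.

Set Implicit Arguments.
Unset Strict Implicit.
Unset Printing Implicit Defensive.

Import finset.
Import Order.TTheory GRing.Theory Num.Theory numFieldNormedType.Exports.
Local Open Scope ring_scope.

(** * Second differences of the factorial *)

(** The difference of the two sides vanishes at [0] and is nondecreasing, because
    [exp (- 2 z) >= 1 - 2 z]. Clearing the denominator of [(1 + z) / (1 - z)] avoids the bound
    [z < 1]. *)
Lemma expR_second_difference_lower (R : realType) (z : R) :
  0 <= z -> (1 - z) * expR (2 * z) <= 1 + z.
Proof.
move=> z0.
pose h (x : R) := (1 + x) - (1 - x) * expR (2 * x).
have hd (x : R) : is_derive x 1 h (1 - expR (2 * x) * (1 - 2 * x)).
  apply: is_derive_eq. rewrite /GRing.scale /=. ring.
have : h 0 <= h z.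
  apply: (@ger0_derive1_le_cc _ h 0 z); rewrite ?in_itv /= ?lexx ?z0 //=.
- move=> x; rewrite in_itv /= => /andP[x0 _].
  rewrite derive1E; case: (hd x) => _ ->.
  have := expR_ge1Dx (- (2 * x)); rewrite expRN => H.
  have e0 := expR_gt0 (2 * x).
  rewrite subr_ge0 mulrC -ler_pdivlMr // div1r. lra.
- apply: derivable_within_continuous => x _; by case: (hd x).
- by rewrite /h mulr0 expR0 !subr0 mulr1 addr0 subrr subr_ge0.
Qed.

(** The expansion of [ln ((1 + z) / (1 - z))] is [2 z + 2 z^3 / 3 + ...]; the coefficient [2] in
    place of [2 / 3] absorbs the tail up to [z = 1/2]. *)
Lemma expR_second_difference_upper (R : realType) (z : R) :
  0 <= z <= 1/2 -> 1 + z <= (1 - z) * expR (2 * z + 2 * z ^+ 3).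
Proof.
move=> /andP[z0 z12].
pose h (x : R) := (1 - x) * expR (2 * x + 2 * x ^+ 3) - (1 + x).
have hd (x : R) : is_derive x 1 h
    (expR (2 * x + 2 * x ^+ 3) * (1 - 2 * x + 6 * x ^+ 2 - 6 * x ^+ 3) - 1).
  apply: is_derive_eq. rewrite /GRing.scale /=. ring.
have : h 0 <= h z.
  apply: (@ger0_derive1_le_cc _ h 0 z); rewrite ?in_itv /= ?lexx ?z0 //=.
- move=> x; rewrite in_itv /= => /andP[x0 xz].
  rewrite derive1E; case: (hd x) => _ ->; rewrite subr_ge0.
  have H := expR_ge1Dx (2 * x + 2 * x ^+ 3).
  have xh : 0 <= 1/2 - x by lra.
  have x2 : 0 <= x ^+ 2 by rewrite exprn_ge0// ltW.
  have x3 : 0 <= x ^+ 3 by rewrite exprn_ge0// ltW.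
  have x5 : 0 <= x ^+ 5 by rewrite exprn_ge0// ltW.
  have P : 0 <= 1 - 2 * x + 6 * x ^+ 2 - 6 * x ^+ 3.
    have := mulr_ge0 x2 xh; lra.
  apply: le_trans (ler_wpM2r P H).
  have := mulr_ge0 x3 xh; have := mulr_ge0 x5 xh; lra.
- apply: derivable_within_continuous => x _; by case: (hd x).
- by rewrite /h mulr0 expr0n /= mulr0 addr0 expR0 !subr0 mulr1 addr0 subrr subr_ge0.
Qed.

Definition factR (R : realType) (n : nat) : R := (n`!)%:R.

Lemma factR_gt0 (R : realType) n : 0 < factR R n.
Proof. by rewrite /factR ltr0n fact_gt0. Qed.

Lemma factRS (R : realType) n : factR R n.+1 = (n%:R + 1) * factR R n.
Proof. by rewrite /factR factS natrM -natr1. Qed.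

(** Going from [t] to [t + 1] multiplies the right side by [(y + j) / (y - j)] with [y = x + 1/2]
    and [j = t + 1/2]. The exponents [2 j / y] add up to exactly [t^2 / y], since
    [(t + 1)^2 - t^2 = 2 j]. *)
Lemma fact_second_difference_lower (R : realType) (x t : nat) : (t <= x)%N ->
  factR R x ^+ 2 * expR (t%:R ^+ 2 / (x%:R + 1/2)) <= factR R (x + t) * factR R (x - t).
Proof.
elim: t => [|t IH] tx.
  by rewrite addn0 subn0 expr0n mul0r expR0 mulr1 expr2.
have {}IH := IH (ltnW tx).
set y : R := x%:R + 1/2 in IH *.
pose j : R := t%:R + 1/2.
have txR : t%:R + 1 <= x%:R :> R by rewrite natr1 ler_nat.
have t0 : 0 <= t%:R :> R by [].
have y0 : 0 < y by rewrite /y; lra.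
have jy : j < y by rewrite /y/j; lra.
have j0 : 0 <= j by rewrite /j; lra.
have E1 : (t.+1)%:R ^+ 2 / y = t%:R ^+ 2 / y + 2 * (j / y).
  rewrite -natr1 /j; field; exact: lt0r_neq0.
rewrite E1 expRD mulrA.
have fx : factR R (x - t) = (y - j) * factR R (x - t.+1).
  have -> : (x - t = (x - t.+1).+1)%N by lia.
  by rewrite factRS natrB// -natr1 /y /j; congr (_ * _); ring.
rewrite addnS factRS natrD.
have -> : x%:R + t%:R + 1 = y + j :> R by rewrite /y /j; field.
have L := expR_second_difference_lower (divr_ge0 j0 (ltW y0)).
have {}L : (y - j) * expR (2 * (j / y)) <= y + j.
  have yD : y + j = y * (1 + j / y) by field; exact: lt0r_neq0.
  have yB : y - j = y * (1 - j / y) by field; exact: lt0r_neq0.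
  by rewrite yB yD -mulrA ler_pM2l.
have e0 := expR_gt0 (2 * (j / y)).
have ab := mulr_ge0 (ltW (factR_gt0 R (x + t))) (ltW (factR_gt0 R (x - t.+1))).
have := ler_wpM2l ab L; have := ler_wpM2r (ltW e0) IH; rewrite fx; lra.
Qed.

(** The same induction with the upper bound on [(y + j) / (y - j)]; the hypothesis keeps [j / y]
    below [1/2], and the cubic corrections [2 (j / y)^3] add up to at most [2 t^4 / y^3]. *)
Lemma fact_second_difference_upper (R : realType) (x t : nat) : (t.*2 <= x)%N ->
  factR R (x + t) * factR R (x - t) <=
  factR R x ^+ 2 * expR (t%:R ^+ 2 / (x%:R + 1/2) + 2 * t%:R ^+ 4 / (x%:R + 1/2) ^+ 3).
Proof.
elim: t => [|t IH] tx.
  by rewrite addn0 subn0 !expr0n !mulr0 !mul0r add0r expR0 mulr1 expr2.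
have {}IH : _ := IH ltac:(lia).
set y : R := x%:R + 1/2 in IH *.
pose j : R := t%:R + 1/2.
have txR : 2 * (t%:R + 1) <= x%:R :> R by rewrite natr1 -natrM ler_nat; lia.
have t0 : 0 <= t%:R :> R by [].
have y0 : 0 < y by rewrite /y; lra.
have jy : 2 * j <= y by rewrite /y/j; lra.
have j0 : 0 <= j by rewrite /j; lra.
have fx : factR R (x - t) = (y - j) * factR R (x - t.+1).
  have -> : (x - t = (x - t.+1).+1)%N by lia.
  by rewrite factRS natrB -?natr1 /y /j; [congr (_ * _); ring | lia].
rewrite addnS factRS natrD.
have -> : x%:R + t%:R + 1 = y + j :> R by rewrite /y /j; field.
have z0 : 0 <= j / y <= 1 / 2.
  by rewrite (divr_ge0 j0 (ltW y0)) ler_pdivrMr//=; lra.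
have L := expR_second_difference_upper z0.
have {}L : y + j <= (y - j) * expR (2 * (j / y) + 2 * (j / y) ^+ 3).
  have yD : y + j = y * (1 + j / y) by field; exact: lt0r_neq0.
  have yB : y - j = y * (1 - j / y) by field; exact: lt0r_neq0.
  by rewrite yB yD -mulrA ler_pM2l.
have j3 : 2 * t%:R ^+ 4 / y ^+ 3 + 2 * (j / y) ^+ 3 <= 2 * t.+1%:R ^+ 4 / y ^+ 3.
  have -> : 2 * t%:R ^+ 4 / y ^+ 3 + 2 * (j / y) ^+ 3
      = (2 * t%:R ^+ 4 + 2 * j ^+ 3) / y ^+ 3 by field; exact: lt0r_neq0.
  rewrite ler_wpM2r ?invr_ge0 ?exprn_ge0 ?(ltW y0)//.
  rewrite -[t.+1%:R]natr1 -subr_ge0 /j.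
  have -> : 2 * (t%:R + 1) ^+ 4 - (2 * t%:R ^+ 4 + 2 * (t%:R + 1 / 2) ^+ 3)
    = 6 * t%:R ^+ 3 + 9 * t%:R ^+ 2 + 13 / 2 * t%:R + 7 / 4 :> R by field.
  have := exprn_ge0 2 t0; have := exprn_ge0 3 t0; lra.
have E1 : t%:R ^+ 2 / y + 2 * t%:R ^+ 4 / y ^+ 3 + (2 * (j / y) + 2 * (j / y) ^+ 3)
   <= (t.+1)%:R ^+ 2 / y + 2 * t.+1%:R ^+ 4 / y ^+ 3.
  have -> : (t.+1)%:R ^+ 2 / y = t%:R ^+ 2 / y + 2 * (j / y).
    by rewrite -[t.+1%:R]natr1 /j; field; exact: lt0r_neq0.
  lra.
rewrite -ler_expR expRD in E1.
apply: (le_trans _ (ler_wpM2l (exprn_ge0 2 (ltW (factR_gt0 R x))) E1)).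
have e0 := expR_gt0 (2 * (j / y) + 2 * (j / y) ^+ 3).
have ab := mulr_ge0 (ltW (factR_gt0 R (x + t))) (ltW (factR_gt0 R (x - t.+1))).
have := ler_wpM2l ab L; have := ler_wpM2r (ltW e0) IH; rewrite fx; lra.
Qed.

(** * The overlap of two sets under a random matching *)

(* Two sets of sizes [k], [l] in a set of [m] points that meet in [a] points split
   it into blocks of sizes [a], [k - a], [l - a] and [m + a - (k + l)]; this is
   the multinomial weight without its factor [m!], times [q] per point of the
   symmetric difference. The explicit guard is needed because the subtractions
   are truncated. *)
Definition overlap_term (R : realType) (q : R) (m k l a : nat) : R :=
  if [&& (a <= k)%N, (a <= l)%N & (k + l <= m + a)%N] then
    q ^+ ((k - a) + (l - a))
    / (factR R a * factR R (k - a) * factR R (l - a) * factR R (m + a - (k + l)))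
  else 0.

Lemma overlap_term_ge0 (R : realType) (q : R) m k l a : 0 <= q -> 0 <= overlap_term q m k l a.
Proof.
move=> q0; rewrite /overlap_term; case: ifP => // _.
by rewrite divr_ge0 ?exprn_ge0// !mulr_ge0// ltW ?factR_gt0.
Qed.

(** Detailed balance between [a] and [a + 1]: one point leaves each difference block, and the
    intersection and the outer block gain one each. Without denominators it also holds where one of
    the two terms vanishes. *)
Lemma overlap_termS (R : realType) (q : R) m k l a : q != 0 ->
  q ^+ 2 * (overlap_term q m k l a.+1 * (a.+1%:R * (m%:R + a.+1%:R - k%:R - l%:R))) =
  overlap_term q m k l a * ((k%:R - a%:R) * (l%:R - a%:R)).
Proof.
move=> q0; rewrite /overlap_term.
have [ak|] := ltnP a k; last first.
  rewrite leq_eqVlt => /orP[/eqP->|ka]; first by rewrite mul0r mulr0 subrr mul0r mulr0.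
  by rewrite (leqNgt a k) ka /= !mul0r mulr0.
have [al|] := ltnP a l; last first.
  rewrite leq_eqVlt => /orP[/eqP->|la]; first by rewrite andbF mul0r mulr0 subrr !mulr0.
  by rewrite (leqNgt a l) la /= andbF !mul0r mulr0.
rewrite (ltnW ak) (ltnW al) /=.
have [H|H] := leqP (k + l) (m + a); last first.
  rewrite mul0r; case: ifP => [H2|_]; last by rewrite mul0r mulr0.
  have -> : m%:R + a.+1%:R - k%:R - l%:R = 0 :> R.
    apply/eqP; rewrite -addrA -opprD subr_eq0 -!natrD eqr_nat; apply/eqP; lia.
  by rewrite !mulr0.
have -> : (k + l <= m + a.+1)%N by lia.
have -> : (k - a = (k - a.+1).+1)%N by lia.
have -> : (l - a = (l - a.+1).+1)%N by lia.
have -> : (m + a.+1 - (k + l) = (m + a - (k + l)).+1)%N by lia.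
rewrite !factRS addSn addnS !exprS.
have Ek : k%:R - a%:R = (k - a.+1)%:R + 1 :> R.
  by rewrite natrB// -natr1; ring.
have El : l%:R - a%:R = (l - a.+1)%:R + 1 :> R.
  by rewrite natrB// -natr1; ring.
have Em : m%:R + a.+1%:R - k%:R - l%:R = (m + a - (k + l))%:R + 1 :> R.
  by rewrite natrB// !natrD -natr1; ring.
rewrite Ek El Em -natr1.
have pos n : n%:R + 1 != 0 :> R by rewrite natr1 pnatr_eq0.
field; rewrite !pos !lt0r_neq0 ?factR_gt0//.
Qed.

(** Detailed balance summed against a test function. On the left the term [a = 0] vanishes; on the
    right the overlap term at [a = m] is nonzero only if [k = m], and then [k - a = 0]. *)
Lemma sum_overlap_ward (R : realType) (q : R) m k l (phi : nat -> R) : q != 0 -> (k <= m)%N ->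
  q ^+ 2 * (\sum_(0 <= a < m.+1) overlap_term q m k l a
     * (a%:R * (m%:R + a%:R - k%:R - l%:R)) * phi a) =
  \sum_(0 <= a < m.+1) overlap_term q m k l a
     * ((k%:R - a%:R) * (l%:R - a%:R)) * phi a.+1.
Proof.
move=> q0 km; rewrite big_nat_recl// mul0r mulr0 mul0r add0r [RHS]big_nat_recr//=.
rewrite [X in _ = _ + X](_ : _ = 0) ?addr0.
  by rewrite mulr_sumr; apply: eq_bigr => a _; rewrite mulrA overlap_termS.
rewrite /overlap_term; case: ifP => [/and3P[mk _ _]|]; last by rewrite !mul0r.
have {km mk}-> : k = m by lia.
by rewrite subrr mul0r mulr0 mul0r.
Qed.

(* With [b = k - a], [c = l - a], [d = m + a - k - l], the identity applied to
   [x = (b + c) / 2 - m / (2 (g + 1))] gives [E[x (g^2 b c - a d)] = g^2 E[b c]], and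
   [g^2 b c - a d] is [x] times a factor of order [m], up to [O(m^(3/2))]. *)
Lemma overlap_second_moment (R : realType) (q g w s : R) m k l :
  1 <= g <= 3 -> q * g = 1 -> 0 < w -> m%:R = w ^+ 2 -> (k <= m)%N ->
  `|k%:R + l%:R - m%:R| <= s -> `|k%:R - l%:R| <= s -> s ^+ 2 <= w ^+ 3 ->
  \sum_(0 <= a < m.+1) overlap_term q m k l a
    * ((k%:R + l%:R) / 2 - a%:R - m%:R / 2 / (g + 1)) ^+ 2
  <= 10 * m%:R * \sum_(0 <= a < m.+1) overlap_term q m k l a.
Proof.
move=> /andP[g1 g3] qg w0 mw km v_s d_s sw.
have q0 : q != 0 by apply: contra_eq_neq qg => ->; rewrite mul0r eq_sym oner_neq0.
have qge0 : 0 <= q by rewrite -(@pmulr_lge0 _ g) ?qg//; lra.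
pose b0 : R := m%:R / 2 / (g + 1).
pose x a : R := (k%:R + l%:R) / 2 - a%:R - b0.
pose G := overlap_term q m k l.
have G0 a : 0 <= G a by exact: overlap_term_ge0.
pose b a : R := k%:R - a%:R; pose c a : R := l%:R - a%:R.
pose d a : R := m%:R + a%:R - k%:R - l%:R.
have W := sum_overlap_ward l x q0 km.
have {W} E : \sum_(0 <= a < m.+1) G a * (x a * (g ^+ 2 * (b a * c a) - a%:R * d a) - g ^+ 2 * (b a * c a)) = 0.
  have -> : \sum_(0 <= a < m.+1) G a * (x a * (g ^+ 2 * (b a * c a) - a%:R * d a) - g ^+ 2 * (b a * c a))
     = g ^+ 2 * (\sum_(0 <= a < m.+1) G a * (b a * c a) * x a.+1)
        - \sum_(0 <= a < m.+1) G a * (a%:R * d a) * x a.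
    rewrite mulr_sumr -sumrB; apply: eq_bigr => a _.
    rewrite /x -natr1; ring.
  rewrite -W mulrA -exprMn [g * q]mulrC qg expr1n mul1r.
  by rewrite subrr.
(* A bound for each [a] suffices: the right side is twice the summand whose sum vanishes by [E]. *)
suff P a : G a * (m%:R * x a ^+ 2 - 10 * m%:R ^+ 2)
   <= 2 * (G a * (x a * (g ^+ 2 * (b a * c a) - a%:R * d a) - g ^+ 2 * (b a * c a))).
  have m0 : 0 < m%:R :> R by rewrite mw exprn_gt0.
  rewrite -(ler_pM2l m0) -subr_le0.
  have -> : m%:R * (\sum_(0 <= a < m.+1) G a * x a ^+ 2)
     - m%:R * (10 * m%:R * (\sum_(0 <= a < m.+1) G a))
     = \sum_(0 <= a < m.+1) G a * (m%:R * x a ^+ 2 - 10 * m%:R ^+ 2).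
    rewrite !mulr_sumr -sumrB; apply: eq_bigr => a _; ring.
  apply: le_trans (ler_sum _ (fun a _ => P a)) _.
  by rewrite -mulr_sumr E mulr0.
have [->|Ga] := eqVneq (G a) 0; first by rewrite !mul0r mulr0.
have /and3P[ak al kl] : [&& (a <= k)%N, (a <= l)%N & (k + l <= m + a)%N].
  by move: Ga; rewrite /G /overlap_term; case: ifP => //; rewrite eqxx.
rewrite [leRHS]mulrCA ler_wpM2l//.
set X := x a.
have akR : a%:R <= k%:R :> R by rewrite ler_nat.
have alR : a%:R <= l%:R :> R by rewrite ler_nat.
have klR : k%:R + l%:R <= m%:R + a%:R :> R by rewrite -!natrD ler_nat.
have a0 : 0 <= a%:R :> R by [].
pose v : R := k%:R + l%:R - m%:R; pose dl : R := k%:R - l%:R.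
pose bb : R := (b a + c a) / 2.
have XE : bb = b0 + X by rewrite /bb /b /c /X /x; field.
have aE : (a%:R + d a) / 2 = g * b0 - X.
  rewrite /b0 /X /x /b0 /d; field; lra.
have b00 : 0 <= b0 by rewrite /b0 !divr_ge0//; lra.
have b0m : (g + 1) * b0 = m%:R / 2 by rewrite /b0; field; lra.
(* Replacing the products [b c] and [a d] by the squares of the means costs the terms in [dl] and
   [v]. The remaining difference of squares factors, with [g bb - (a + d) / 2 = (g + 1) X]. *)
have key : g ^+ 2 * (b a * c a) - a%:R * d a
    = (g + 1) * X * (g * bb + (a%:R + d a) / 2) - (g ^+ 2 * dl ^+ 2 - v ^+ 2) / 4.
  rewrite aE XE.
  have -> : b a * c a = bb ^+ 2 - dl ^+ 2 / 4 by rewrite /bb /b /c /dl; field.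
  have -> : a%:R * d a = ((a%:R + d a) / 2) ^+ 2 - v ^+ 2 / 4 by rewrite /d /v; field.
  by rewrite aE XE; field.
have bb0 : 0 <= bb by rewrite /bb /b /c; lra.
have dd0 : 0 <= (a%:R + d a) / 2 by rewrite /d; lra.
have sumH : bb + (a%:R + d a) / 2 = m%:R / 2 by rewrite /bb /b /c /d; field.
have main1 : m%:R * X ^+ 2 <= (g + 1) * X ^+ 2 * (g * bb + (a%:R + d a) / 2).
  have X2 : 0 <= X ^+ 2 by exact: sqr_ge0.
  have T1 : 0 <= (g - 1) * bb by rewrite mulr_ge0//; lra.
  have T2 : m%:R / 2 <= g * bb + (a%:R + d a) / 2 by lra.
  have T3 : 0 <= m%:R :> R by [].
  have T4 : m%:R <= (g + 1) * (g * bb + (a%:R + d a) / 2).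
    have : 0 <= (g - 1) * (g * bb + (a%:R + d a) / 2) by rewrite mulr_ge0//; lra.
    lra.
  by have := ler_wpM2r X2 T4; lra.
have bc : b a * c a <= m%:R ^+ 2 / 4.
  have h1 : 0 <= (b a - c a) ^+ 2 by exact: sqr_ge0.
  have h2 : 0 <= (m%:R / 2 - bb) * (m%:R / 2 + bb) by rewrite mulr_ge0//; lra.
  have h3 : b a * c a = bb ^+ 2 - (b a - c a) ^+ 2 / 4 by rewrite /bb; field.
  lra.
have g9 : g ^+ 2 <= 9.
  have : 0 <= (3 - g) * (g + 3) by rewrite mulr_ge0//; lra.
  lra.
have g2 : 1 <= g ^+ 2 by rewrite expr_ge1//; lra.
have bc9 : g ^+ 2 * (b a * c a) <= 9 * (m%:R ^+ 2 / 4).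
  have bc0 : 0 <= b a * c a by rewrite /b /c mulr_ge0//; lra.
  by have := ler_wpM2r bc0 g9; lra.
have Y : `|(g ^+ 2 * dl ^+ 2 - v ^+ 2) / 4| <= 9 / 4 * w ^+ 3.
  have v2 : v ^+ 2 <= w ^+ 3.
    apply: le_trans sw; rewrite -(real_normK (num_real v)) ler_sqr ?nnegrE//.
    exact: le_trans (normr_ge0 _) v_s.
  have d2 : dl ^+ 2 <= w ^+ 3.
    apply: le_trans sw; rewrite -(real_normK (num_real dl)) ler_sqr ?nnegrE//.
    exact: le_trans (normr_ge0 _) d_s.
  have v0 : 0 <= v ^+ 2 by exact: sqr_ge0.
  have d0 : 0 <= dl ^+ 2 by exact: sqr_ge0.
  have gd : g ^+ 2 * dl ^+ 2 <= 9 * dl ^+ 2 by rewrite ler_wpM2r.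
  have gd0 : 0 <= g ^+ 2 * dl ^+ 2 by rewrite mulr_ge0// sqr_ge0.
  rewrite ler_norml; apply/andP; split; lra.
pose y := (g ^+ 2 * dl ^+ 2 - v ^+ 2) / 4; rewrite -/y in Y key.
have Xy : X * y <= `|X| * (9 / 4 * w ^+ 3).
  apply: le_trans (ler_norm _) _; by rewrite normrM ler_wpM2l.
(* Completing the square gives half of the main term [2 m X^2] away to absorb [X y]. The total loss
   is [81/16 + 9/2 < 10] times [m^2]. *)
have AM : 0 <= (`|X| * w - 9 / 4 * w ^+ 2) ^+ 2 by exact: sqr_ge0.
have NX : `|X| ^+ 2 = X ^+ 2 by rewrite real_normK// num_real.
have AM2 : (`|X| * w - 9 / 4 * w ^+ 2) ^+ 2 =
   X ^+ 2 * w ^+ 2 + 81/16 * w ^+ 4 - 2 * (`|X| * (9 / 4 * w ^+ 3)) by rewrite -NX; field.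
rewrite key mw; rewrite mw in main1 bc9.
have w4 : 0 <= w ^+ 4 by rewrite exprn_ge0// ltW.
have XX : X * ((g + 1) * X * (g * bb + (a%:R + d a) / 2) - y)
  = (g + 1) * X ^+ 2 * (g * bb + (a%:R + d a) / 2) - X * y by ring.
rewrite XX; lra.
Qed.

Lemma ler_sum_inj (R : numDomainType) (I J : finType) (P : pred I) (Q : pred J)
    (h : I -> J) (f : J -> R) :
  {in P &, injective h} -> (forall i, P i -> Q (h i)) -> (forall j, 0 <= f j) ->
  \sum_(i | P i) f (h i) <= \sum_(j | Q j) f j.
Proof.
move=> hinj PQ f0.
rewrite -(@big_imset R 0 +%R _ _ h P f hinj) /= [leLHS]big_mkcond [leRHS]big_mkcond.
apply: ler_sum => j _; case: ifP => [/imsetP[i iP ->]|_]; first by rewrite PQ.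
by case: ifP.
Qed.

(** Cauchy-Schwarz without square roots, one index at a time; the cross term is handled by the
    inequality of arithmetic and geometric means. *)
Lemma sumr_sqr_le (R : realType) (I : finType) (P : pred I) (p q r : I -> R) :
  (forall i, P i -> [/\ 0 <= p i, 0 <= q i, 0 <= r i & r i ^+ 2 <= p i * q i]) ->
  (\sum_(i | P i) r i) ^+ 2 <= (\sum_(i | P i) p i) * (\sum_(i | P i) q i).
Proof.
move=> H.
suff [] : [/\ 0 <= \sum_(i | P i) p i, 0 <= \sum_(i | P i) q i, 0 <= \sum_(i | P i) r i &
  (\sum_(i | P i) r i) ^+ 2 <= (\sum_(i | P i) p i) * (\sum_(i | P i) q i)] by [].
elim/big_rec3 : _ => [|i x y z Pi [z0 y0 x0 xyz]]; first by split; rewrite // expr0n mulr0.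
have {H Pi} [p0 q0 r0 pqr] := H _ Pi; split; rewrite ?addr_ge0//.
have : r i * x *+ 2 <= p i * y + z * q i.
  rewrite -ler_sqr ?nnegrE ?addr_ge0 ?mulrn_wge0 ?mulr_ge0//.
  have := ler_pM (sqr_ge0 _) (sqr_ge0 _) pqr xyz.
  have := sqr_ge0 (p i * y - z * q i).
  lra.
lra.
Qed.

(** * Second differences at the typical overlap *)

Section SecondDifference.
Variables (R : realType).

(** The exponent in [fact_second_difference_upper]. *)
Definition second_difference_bound (t x : R) : R :=
  t ^+ 2 / (x + 1 / 2) + 2 * t ^+ 4 / (x + 1 / 2) ^+ 3.

(** Here [w^2] is the number [m] of points, and [a], [d] are the sizes of the plus-plus and
    minus-minus blocks, whose mean is at least its typical value [a0] minus [5 w]. The quadratic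
    terms then exceed their value at [a0] by a constant because [s^2 <= w^3], and the quartic terms
    are bounded because [s^4 <= w^6]. *)
Lemma second_difference_bound_le (g w s a d : R) :
  1 <= g <= 3 -> 40 ^+ 2 <= w -> 0 <= s -> s ^+ 2 <= w ^+ 3 ->
  `|a - d| <= s -> w ^+ 2 / 2 * g / (g + 1) - 5 * w <= (a + d) / 2 ->
  [/\ 4 * s <= a, 4 * s <= d
    & second_difference_bound (2 * s) a + second_difference_bound (2 * s) d
      <= (2 * s) ^+ 2 * (4 * (g + 1) / (g * w ^+ 2)) + 66 * 10 ^+ 3].
Proof.
move=> /andP[g1 g3] w1600 s0 sw ad Aad.
set a0 := w ^+ 2 / 2 * g / (g + 1) in Aad.
have w0 : 0 < w by lra.
have w2 : 40 ^+ 2 * w <= w ^+ 2 by rewrite expr2 ler_pM2r.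
have w2p : 0 < w ^+ 2 by rewrite exprn_gt0.
have a0w : w ^+ 2 / 4 <= a0.
  have g0 : 0 < g + 1 by lra.
  rewrite /a0 ler_pdivlMr//.
  have : 0 <= (g - 1) * w ^+ 2 by rewrite mulr_ge0 ?sqr_ge0//; lra.
  lra.
have sw2 : s <= w ^+ 2 / 40.
  rewrite -ler_sqr ?nnegrE ?divr_ge0 ?sqr_ge0//; apply: le_trans sw _.
  have : 40 ^+ 2 * w ^+ 3 <= w * w ^+ 3 by rewrite ler_wpM2r ?exprn_ge0// ltW.
  by rewrite -exprS expr_div_n -exprM; lra.
pose v := (a - d) / 2; pose y := (a + d) / 2 + 1 / 2.
have pE : a + 1/2 = y + v by rewrite /y /v; field.
have rE : d + 1/2 = y - v by rewrite /y /v; field.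
have [v1 v2] : v <= s / 2 /\ - (s / 2) <= v.
  by move: ad; rewrite ler_norml => /andP[? ?]; rewrite /v; split; lra.
have yw : w ^+ 2 / 5 <= y by rewrite /y; lra.
have pw : w ^+ 2 / 10 <= a + 1/2 by rewrite pE; lra.
have rw : w ^+ 2 / 10 <= d + 1/2 by rewrite rE; lra.
have aE : a = (a + d) / 2 + v by rewrite /v; field.
have dE : d = (a + d) / 2 - v by rewrite /v; field.
have ag : 4 * s <= a by rewrite aE; lra.
have dg : 4 * s <= d by rewrite dE; lra.
split=> //; clear ag dg aE dE.
have w3 : 0 < w ^+ 3 by rewrite exprn_gt0.
have a0E : 4 * (g + 1) / (g * w ^+ 2) = 2 / a0.
  rewrite /a0; field; rewrite !lt0r_neq0//; lra.
rewrite a0E.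
(* Of the [7 w], [5 w] is the allowed deviation of the mean; the other [2 w] pays for replacing
   [y^2 - v^2] by [y z], as [v^2 <= w^3 / 4] and [y >= w^2 / 5]. *)
pose z := a0 - 7 * w.
have zw : w ^+ 2 / 5 <= z by rewrite /z; lra.
have p0 : 0 < a + 1/2 by lra.
have r0 : 0 < d + 1/2 by lra.
have y0 : 0 < y by lra.
have z0 : 0 < z by lra.
have v4 : v ^+ 2 <= w ^+ 3 / 4.
  have : 0 <= (s / 2 - v) * (s / 2 + v) by rewrite mulr_ge0//; lra.
  lra.
have inv_sum : (a + 1/2)^-1 + (d + 1/2)^-1 <= 2 / z.
  have -> : (a + 1/2)^-1 + (d + 1/2)^-1 = 2 * y / ((a + 1/2) * (d + 1/2)).
    rewrite /y; field; rewrite !lt0r_neq0//; lra.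
  rewrite ler_pdivrMr ?mulr_gt0// mulrAC ler_pdivlMr// -[leLHS]mulrA ler_pM2l//.
  rewrite pE rE.
  have yz : 2 * w <= y - z by rewrite /z /y; lra.
  have w5 : 0 <= w ^+ 2 / 5 by rewrite divr_ge0// ltW.
  have ww : 0 <= 2 * w by rewrite mulr_ge0// ltW.
  have := ler_pM w5 ww yw yz.
  have -> : w ^+ 2 / 5 * (2 * w) = 2 / 5 * w ^+ 3 by ring.
  lra.
have diff : 2 / z <= 2 / a0 + 280 / w ^+ 3.
  have a00 : 0 < a0 by lra.
  have -> : 2 / z = 2 / a0 + 14 * w / (z * a0).
    rewrite /z; field; rewrite !lt0r_neq0//; lra.
  rewrite lerD2l (ler_pdivrMr _ _ (mulr_gt0 z0 a00)) mulrAC ler_pdivlMr//.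
  have z5 : 0 <= w ^+ 2 / 5 by rewrite divr_ge0// ltW.
  have z4 : 0 <= w ^+ 2 / 4 by rewrite divr_ge0// ltW.
  have := ler_pM z5 z4 zw a0w.
  have -> : w ^+ 2 / 5 * (w ^+ 2 / 4) = w * w ^+ 3 / 20 by field.
  lra.
have sq : (2 * s) ^+ 2 * ((a + 1/2)^-1 + (d + 1/2)^-1) <= (2 * s) ^+ 2 * (2 / a0) + 112 * 10.
  have S0 : 0 <= (2 * s) ^+ 2 by exact: sqr_ge0.
  apply: le_trans (ler_wpM2l S0 (le_trans inv_sum diff)) _.
  rewrite mulrDr lerD2l exprMn.
  rewrite mulrA ler_pdivrMr//; lra.
have cub x : w ^+ 2 / 10 <= x -> 2 * (2 * s) ^+ 4 / x ^+ 3 <= 32 * 10 ^+ 3.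
  move=> xw; have x0 : 0 < x by lra.
  rewrite ler_pdivrMr ?exprn_gt0//.
  have s4 : s ^+ 4 <= w ^+ 6.
    by rewrite (exprM s 2 2) (exprM w 3 2) ler_sqr ?nnegrE ?sqr_ge0// ltW.
  have w10 : 0 <= w ^+ 2 / 10 by rewrite divr_ge0// ltW.
  have : (w ^+ 2 / 10) ^+ 3 <= x ^+ 3 by apply: lerXn2r; rewrite ?nnegrE// ltW.
  rewrite expr_div_n -exprM exprMn; lra.
have := cub _ pw; have := cub _ rw.
rewrite /second_difference_bound; lra.
Qed.

End SecondDifference.

Lemma sqr_quotient_le (R : realFieldType) (x fa fb fc fd fap fam fdp fdm e1 e2 : R) :
  0 <= x -> 0 < fa -> 0 < fb -> 0 < fc -> 0 < fd ->
  0 < fap -> 0 < fam -> 0 < fdp -> 0 < fdm -> 0 < e1 -> 0 < e2 ->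
  fap * fam * (fdp * fdm) <= fa ^+ 2 * e1 * (fd ^+ 2 * e2) ->
  (x / (fa * fb * fc * fd)) ^+ 2 / (e1 * e2) <=
  x / (fap * fb * fc * fdm) * (x / (fam * fb * fc * fdp)).
Proof.
move=> x0 a0 b0 c0 d0 ap am dp dm e10 e20 H.
have -> : (x / (fa * fb * fc * fd)) ^+ 2 / (e1 * e2) =
    (x / (fb * fc)) ^+ 2 * (fa ^+ 2 * e1 * (fd ^+ 2 * e2))^-1.
  by field; rewrite !lt0r_neq0.
have -> : x / (fap * fb * fc * fdm) * (x / (fam * fb * fc * fdp)) =
    (x / (fb * fc)) ^+ 2 * (fap * fam * (fdp * fdm))^-1.
  by field; rewrite !lt0r_neq0.
by rewrite ler_wpM2l ?sqr_ge0// lef_pV2 ?posrE ?mulr_gt0 ?exprn_gt0.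
Qed.

(** * Overlap sums under a common shift of both sizes *)

Section OverlapSum.
Variables (R : realType) (q g w : R) (m k l s : nat).
Hypotheses (hg : 1 <= g <= 3) (qg : q * g = 1) (hw : 40 ^+ 2 <= w)
  (mw : m%:R = w ^+ 2) (km : (k <= m)%N)
  (kl_sum : `|k%:R + l%:R - m%:R| <= s%:R :> R)
  (kl_diff : `|k%:R - l%:R| <= s%:R :> R) (sw : s%:R ^+ 2 <= w ^+ 3).

Let q_ge0 : 0 <= q.
Proof. by rewrite -(@pmulr_lge0 _ g) ?qg//; case/andP: hg => ? _; lra. Qed.

Let w_gt0 : 0 < w. Proof. by apply: lt_le_trans hw; rewrite exprn_gt0. Qed.

(** Up to factorials, the weight of one random matching given the two sizes (see [perm_sumE]). The
    arguments shadow the section variables so that shifted sizes can be inserted. *)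
Definition overlap_sum (k l : nat) : R := \sum_(a < m.+1) overlap_term q m k l a.

Let dev (a : nat) : R := (k%:R + l%:R) / 2 - a%:R - m%:R / 2 / (g + 1).

Let typical (a : 'I_m.+1) :=
  [&& (a <= k)%N, (a <= l)%N, (k + l <= m + a)%N & `|dev a| <= 5 * w].

(** Chebyshev's inequality: with second moment at most [10 w^2], deviations above [5 w] carry at
    most [10 / 25] of the sum. *)
Lemma sum_typical_overlap_ge : overlap_sum k l / 2 <=
  \sum_(a < m.+1 | typical a) overlap_term q m k l a.
Proof.
have M := overlap_second_moment hg qg w_gt0 mw km kl_sum kl_diff sw.
rewrite !big_mkord -/(overlap_sum k l) mw in M.
have w2 : 0 < w ^+ 2 by rewrite exprn_gt0.
suff B : 25 * w ^+ 2 * (\sum_(a < m.+1 | ~~ typical a) overlap_term q m k l a)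
    <= 10 * w ^+ 2 * overlap_sum k l.
  have FE : overlap_sum k l = \sum_(a < m.+1 | typical a) overlap_term q m k l a
      + \sum_(a < m.+1 | ~~ typical a) overlap_term q m k l a.
    by rewrite /overlap_sum (bigID typical).
  have F0 : 0 <= \sum_(a < m.+1 | typical a) overlap_term q m k l a.
    by apply: sumr_ge0 => a _; exact: overlap_term_ge0.
  rewrite FE in B *; move: F0 B.
  move: (\sum_(_ < _ | typical _) _) (\sum_(_ < _ | ~~ typical _) _) => X Y F0.
  move: (w ^+ 2) w2 => W W0 B.
  have WX := mulr_ge0 (ltW W0) F0; rewrite -(ler_pM2l W0); lra.
apply: le_trans M; rewrite mulr_sumr big_mkcond; apply: ler_sum => a _ /=.
have G0 := overlap_term_ge0 m k l a q_ge0.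
case: ifP => [|_]; last by rewrite mulr_ge0// sqr_ge0.
have [V|V] := boolP [&& (a <= k)%N, (a <= l)%N & (k + l <= m + a)%N]; last first.
  by rewrite /overlap_term (negPf V) mulr0 mul0r.
move: V => /and3P[ak al kla]; rewrite /typical ak al kla /= -ltNge => D.
rewrite [leLHS]mulrC ler_wpM2l// -mw -/(dev a) mw.
have -> : 25 * w ^+ 2 = (5 * w) ^+ 2 by ring.
rewrite -[leRHS]real_normK ?num_real// ler_sqr ?nnegrE// ?(ltW D)//.
by rewrite mulr_ge0// ltW.
Qed.

(** The shift by [(t, t, t)] fixes [k - a] and [l - a], hence the power of [q] and two of the
    factorials. Only the blocks [a] and [m + a - (k + l)] move, in opposite directions. *)
Lemma overlap_term_shift (t a : nat) :
  (a <= k)%N -> (a <= l)%N -> (k + l <= m + a)%N ->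
  (t.*2 <= a)%N -> (t.*2 <= m + a - (k + l))%N ->
  overlap_term q m k l a ^+ 2
    * expR (- (second_difference_bound t%:R a%:R
               + second_difference_bound t%:R (m + a - (k + l))%:R)) <=
  overlap_term q m (k + t) (l + t) (a + t) * overlap_term q m (k - t) (l - t) (a - t).
Proof.
move=> ak al kla ta td; rewrite /overlap_term ak al kla /=.
have -> : [&& (a + t <= k + t)%N, (a + t <= l + t)%N & (k + t + (l + t) <= m + (a + t))%N].
  clear -ak al kla td; lia.
have -> : [&& (a - t <= k - t)%N, (a - t <= l - t)%N & (k - t + (l - t) <= m + (a - t))%N].
  clear -ak al kla ta; lia.
rewrite !subnDr.
have -> : (k - t - (a - t) = k - a)%N by clear -ak ta; lia.
have -> : (l - t - (a - t) = l - a)%N by clear -al ta; lia.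
have -> : (m + (a + t) - (k + t + (l + t)) = (m + a - (k + l)) - t)%N by clear; lia.
have -> : (m + (a - t) - (k - t + (l - t)) = (m + a - (k + l)) + t)%N.
  clear -ak al kla ta; lia.
set d := (m + a - (k + l))%N in td *.
have Ha := fact_second_difference_upper R ta.
have Hd := fact_second_difference_upper R td.
rewrite -!/(second_difference_bound _ _) in Ha Hd.
have p0 n := factR_gt0 R n.
have H := ler_pM (mulr_ge0 (ltW (p0 _)) (ltW (p0 _))) (mulr_ge0 (ltW (p0 _)) (ltW (p0 _))) Ha Hd.
rewrite expRN expRD; apply: sqr_quotient_le H; rewrite ?exprn_ge0// ?expR_gt0//; exact: p0.
Qed.

Let err : R := (2 * s%:R) ^+ 2 * (4 * (g + 1) / (g * w ^+ 2)) + 66 * 10 ^+ 3.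

(** The termwise comparison is summed over typical [a] by Cauchy-Schwarz; these carry half of the
    sum, whence the factor [1 / 4]. *)
Lemma overlap_sum_shift :
  expR (- err) / 4 * overlap_sum k l ^+ 2 <=
  overlap_sum (k + s.*2) (l + s.*2) * overlap_sum (k - s.*2) (l - s.*2).
Proof.
set t := s.*2.
have tE : t%:R = 2 * s%:R :> R by rewrite -natrM mul2n.
pose p (a : 'I_m.+1) := overlap_term q m (k + t) (l + t) (a + t).
pose r (a : 'I_m.+1) := overlap_term q m (k - t) (l - t) (a - t).
pose o (a : 'I_m.+1) := overlap_term q m k l a * expR (- err / 2).
have T0 := overlap_term_ge0.
have e2E : expR (- err / 2) ^+ 2 = expR (- err).
  by rewrite -expRM_natl; congr expR; field.
have typ (a : 'I_m.+1) : typical a ->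
    [/\ (t.*2 <= a)%N, (t.*2 <= m + a - (k + l))%N & o a ^+ 2 <= p a * r a].
  move=> /and4P[ak al kla]; rewrite ler_norml => /andP[_ D].
  have dE : (m + a - (k + l))%:R = m%:R + a%:R - (k%:R + l%:R) :> R.
    by rewrite natrB// !natrD.
  have ad : `|a%:R - (m + a - (k + l))%:R| <= s%:R :> R.
    by rewrite dE; have -> : a%:R - (m%:R + a%:R - (k%:R + l%:R)) = k%:R + l%:R - m%:R :> R by ring.
  have Aad : w ^+ 2 / 2 * g / (g + 1) - 5 * w <= (a%:R + (m + a - (k + l))%:R) / 2.
    have -> : w ^+ 2 / 2 * g / (g + 1) = m%:R / 2 - m%:R / 2 / (g + 1).
      by rewrite mw; field; case/andP: hg => ? _; lra.
    by rewrite dE; move: D; rewrite /dev; lra.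
  have [ag dg E] := second_difference_bound_le hg hw (ler0n _ s) sw ad Aad.
  have ta : (t.*2 <= a)%N by rewrite -(ler_nat R) -mul2n natrM tE; move: ag; lra.
  have td : (t.*2 <= m + a - (k + l))%N.
    by rewrite -(ler_nat R) -[t.*2]mul2n natrM tE; move: dg; lra.
  split=> //; apply: le_trans (overlap_term_shift ak al kla ta td).
  rewrite exprMn e2E.
  by rewrite ler_wpM2l ?sqr_ge0// ler_expR lerN2 tE.
have CS : (\sum_(a < m.+1 | typical a) o a) ^+ 2 <=
    (\sum_(a < m.+1 | typical a) p a) * (\sum_(a < m.+1 | typical a) r a).
  apply: sumr_sqr_le => a /typ[_ _ ?]; split; rewrite ?T0//.
  by rewrite mulr_ge0 ?T0 ?expR_ge0.
have Sp : \sum_(a < m.+1 | typical a) p a <= overlap_sum (k + t) (l + t).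
  have tm (a : 'I_m.+1) : typical a -> (a + t < m.+1)%N.
    move=> Ta; have [_ td _] := typ _ Ta; case/and4P: Ta => ak al kla _.
    clear -td ak al kla; lia.
  apply: le_trans (@ler_sum_inj R _ _ typical xpredT (fun a => inord (a + t)) _ _ _ _) => //.
  - rewrite le_eqVlt; apply/orP; left; apply/eqP; apply: eq_bigr => a Ta.
    by rewrite /p inordK// tm.
  - move=> a b Ta Tb /(congr1 (@nat_of_ord _)); rewrite !inordK ?tm// => /addIn E.
    exact: val_inj.
  - by move=> j; exact: T0.
have Sr : \sum_(a < m.+1 | typical a) r a <= overlap_sum (k - t) (l - t).
  have tm (a : 'I_m.+1) : (a - t < m.+1)%N by rewrite ltnS (leq_trans (leq_subr _ _))// -ltnS.
  apply: le_trans (@ler_sum_inj R _ _ typical xpredT (fun a => inord (a - t)) _ _ _ _) => //.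
  - rewrite le_eqVlt; apply/orP; left; apply/eqP; apply: eq_bigr => a Ta.
    by rewrite /r inordK// tm.
  - move=> a b Ta Tb /(congr1 (@nat_of_ord _)); rewrite !inordK ?tm// => E.
    have [ta _ _] := typ _ Ta; have [tb _ _] := typ _ Tb.
    apply: val_inj => /=; clear -ta tb E; lia.
  - by move=> j; exact: T0.
apply: le_trans (_ : (\sum_(a < m.+1 | typical a) o a) ^+ 2 <= _).
  rewrite -mulr_suml exprMn e2E.
  have -> : expR (- err) / 4 * overlap_sum k l ^+ 2
    = (overlap_sum k l / 2) ^+ 2 * expR (- err) by field.
  rewrite ler_wpM2r ?expR_ge0//.
  have S0 : 0 <= overlap_sum k l by apply: sumr_ge0 => a _; exact: T0.
  have S1 := sum_typical_overlap_ge.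
  rewrite ler_sqr ?nnegrE ?(le_trans _ S1)// ?divr_ge0//.
apply: le_trans CS _; apply: ler_pM => //; apply: sumr_ge0 => a _; exact: T0.
Qed.

End OverlapSum.

(** * The annealed weight of the two magnetizations *)

Lemma ler_pXn2r (R : realDomainType) (n : nat) (x y : R) : 0 <= x -> x <= y -> x ^+ n <= y ^+ n.
Proof. by move=> x0 xy; apply: lerXn2r; rewrite ?nnegrE// (le_trans x0). Qed.

Section ClassWeight.
Variables (R : realType) (Delta : nat).
Hypothesis hDelta : (3 <= Delta)%N.

Let q : R := (Delta%:R - 2) / Delta%:R.
Let g : R := Delta%:R / (Delta%:R - 2).

Let D3 : 3 <= Delta%:R :> R. Proof. by rewrite ler_nat. Qed.

Let hg : 1 <= g <= 3.
Proof.
have D2 : 0 < Delta%:R - 2 :> R by move: D3; lra.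
by rewrite /g ler_pdivlMr// ler_pdivrMr//; apply/andP; split; move: D3; lra.
Qed.

Let qg : q * g = 1.
Proof. by rewrite /q /g; field; apply/andP; split; rewrite lt0r_neq0//; move: D3; lra. Qed.

Let q_ge0 : 0 <= q. Proof. by rewrite /q divr_ge0//; move: D3; lra. Qed.

Definition classes_fact (m k : nat) : R := factR R k * factR R (m - k).

(** Up to the factor [m!^2], the total weight of all pairs of sets of sizes [k], [l] under [Delta]
    independent matchings. The numbers of such sets lower the power of the factorials from [Delta]
    to [Delta.-1]. *)
Definition class_weight (m k l : nat) : R :=
  (classes_fact m k * classes_fact m l) ^+ Delta.-1 * overlap_sum q m k l ^+ Delta.

Lemma class_weight_ge0 m k l : 0 <= class_weight m k l.
Proof.
rewrite /class_weight mulr_ge0// exprn_ge0//.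
  by rewrite !mulr_ge0// ltW ?factR_gt0.
by rewrite sumr_ge0// => a _; exact: overlap_term_ge0.
Qed.

(** The lower bound is used at [k] and at [m - k], with [1 / x + 1 / y >= 4 / (x + y)] where
    [x = k + 1/2], [y = m - k + 1/2] and [x + y = m + 1]. *)
Lemma classes_fact_shift m k t : (t <= k)%N -> (k + t <= m)%N ->
  classes_fact m k ^+ 2 * expR (4 * t%:R ^+ 2 / (m%:R + 1)) <=
  classes_fact m (k + t) * classes_fact m (k - t).
Proof.
move=> tk ktm.
have tmk : (t <= m - k)%N by lia.
have H1 := fact_second_difference_lower R tk.
have H2 := fact_second_difference_lower R tmk.
have f0 n := factR_gt0 R n.
have e0 x := expR_ge0 (x : R).
have H := ler_pM (mulr_ge0 (exprn_ge0 2 (ltW (f0 _))) (e0 _))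
  (mulr_ge0 (exprn_ge0 2 (ltW (f0 _))) (e0 _)) H1 H2.
rewrite /classes_fact.
have -> : (m - (k + t) = m - k - t)%N by lia.
have -> : (m - (k - t) = m - k + t)%N by lia.
apply: le_trans (_ : _ <= factR R k ^+ 2 * expR (t%:R ^+ 2 / (k%:R + 1 / 2)) *
    (factR R (m - k) ^+ 2 * expR (t%:R ^+ 2 / ((m - k)%:R + 1 / 2)))) _; last first.
  apply: le_trans H _; rewrite le_eqVlt; apply/orP; left; apply/eqP; ring.
rewrite mulrACA -expRD exprMn ler_wpM2l ?mulr_ge0 ?sqr_ge0// ler_expR.
have km : (k <= m)%N by lia.
rewrite natrB//.
have k0 : 0 <= k%:R :> R by [].
have mkR : 0 <= m%:R - k%:R :> R by rewrite subr_ge0 ler_nat.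
set x := k%:R + 1/2; set y := _ + 1/2.
have x0 : 0 < x by rewrite /x; lra.
have y0 : 0 < y by rewrite /y; lra.
have -> : m%:R + 1 = x + y by rewrite /x /y; field.
have -> : t%:R ^+ 2 / x + t%:R ^+ 2 / y = t%:R ^+ 2 * (x + y) / (x * y).
  by field; rewrite !lt0r_neq0.
have xy0 := addr_gt0 x0 y0.
rewrite ler_pdivrMr// mulrAC ler_pdivlMr ?mulr_gt0//.
have := mulr_ge0 (sqr_ge0 (t%:R : R)) (sqr_ge0 (x - y)); lra.
Qed.

(** The square root of the constant for the product of the two shifted weights. The [66 * 10 ^+ 3]
    comes from each overlap sum, and the [1] covers the mismatch between [m] and [m + 1] in the
    leading exponents. *)
Definition shift_const : R := expR (- (Delta%:R * (1 + 66 * 10 ^+ 3)) / 2) / 2 ^+ Delta.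

(** What the overlap sums lose under the shift, the vertex factorials gain, up to a bounded factor.
    So the product of the two shifted weights is at least [shift_const ^+ 2] times the square of the
    central one, and the square of their sum exceeds their product. *)
Lemma class_weight_shift (w : R) (m k l s : nat) :
  40 ^+ 2 <= w -> m%:R = w ^+ 2 -> s%:R ^+ 2 <= w ^+ 3 ->
  `|k%:R + l%:R - m%:R| <= s%:R :> R -> `|k%:R - l%:R| <= s%:R :> R ->
  (s.*2 <= k)%N -> (k + s.*2 <= m)%N -> (s.*2 <= l)%N -> (l + s.*2 <= m)%N ->
  shift_const * class_weight m k l <=
  class_weight m (k + s.*2) (l + s.*2) + class_weight m (k - s.*2) (l - s.*2).
Proof.
move=> hw mw sw kls kld sk km sl lm.
have km' : (k <= m)%N := leq_trans (leq_addr _ _) km.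
have F := overlap_sum_shift hg qg hw mw km' kls kld sw.
have Dk := classes_fact_shift sk km.
have Dl := classes_fact_shift sl lm.
have c0 j : 0 < classes_fact m j by rewrite /classes_fact mulr_gt0 ?factR_gt0.
have F0 i j : 0 <= overlap_sum q m i j.
  by apply: sumr_ge0 => a _; exact: overlap_term_ge0.
have e0 (x : R) : 0 <= expR x := expR_ge0 x.
have W0 := class_weight_ge0.
have c1 : 0 <= shift_const by rewrite /shift_const divr_ge0// exprn_ge0.
rewrite -ler_sqr ?nnegrE; [|exact: mulr_ge0|exact: addr_ge0].
suff : (shift_const * class_weight m k l) ^+ 2 <=
  class_weight m (k + s.*2) (l + s.*2) * class_weight m (k - s.*2) (l - s.*2).
  have := sqr_ge0 (class_weight m (k + s.*2) (l + s.*2)).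
  have := sqr_ge0 (class_weight m (k - s.*2) (l - s.*2)).
  have := mulr_ge0 (W0 m (k + s.*2)%N (l + s.*2)%N) (W0 m (k - s.*2)%N (l - s.*2)%N).
  lra.
set kp := (k + _)%N in Dk F *; set lp := (l + _)%N in Dl F *.
set kn := (k - _)%N in Dk F *; set ln := (l - _)%N in Dl F *.
set ek := expR _ in Dk Dl; set ef := expR _ in F.
have step : (classes_fact m k ^+ 2 * ek * (classes_fact m l ^+ 2 * ek)) ^+ Delta.-1
    * (ef / 4 * overlap_sum q m k l ^+ 2) ^+ Delta
    <= class_weight m kp lp * class_weight m kn ln.
  have -> : class_weight m kp lp * class_weight m kn ln =
    ((classes_fact m kp * classes_fact m kn) * (classes_fact m lp * classes_fact m ln)) ^+ Delta.-1
    * (overlap_sum q m kp lp * overlap_sum q m kn ln) ^+ Delta.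
    by rewrite /class_weight !exprMn; ring.
  have P1 j : 0 <= classes_fact m j ^+ 2 * ek by rewrite mulr_ge0 ?sqr_ge0 ?e0.
  have P2 : 0 <= ef / 4 * overlap_sum q m k l ^+ 2.
    by rewrite mulr_ge0 ?sqr_ge0 ?divr_ge0 ?e0.
  apply: ler_pM; [|exact: exprn_ge0|apply: ler_pXn2r|exact: ler_pXn2r].
  - by apply: exprn_ge0; exact: mulr_ge0.
  - exact: mulr_ge0.
  - exact: ler_pM.
apply: le_trans step.
have -> : (classes_fact m k ^+ 2 * ek * (classes_fact m l ^+ 2 * ek)) ^+ Delta.-1
    * (ef / 4 * overlap_sum q m k l ^+ 2) ^+ Delta
  = (ek ^+ (2 * Delta.-1) * ef ^+ Delta / 4 ^+ Delta) * class_weight m k l ^+ 2.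
  rewrite /class_weight !exprMn !exprVn exprM -!exprM ![(_ * 2)%N]mulnC ![(2 * _)%N]mulnC.
  rewrite !exprM. ring.
rewrite exprMn ler_wpM2r ?sqr_ge0//.
have -> : shift_const ^+ 2 = expR (- (Delta%:R * (1 + 66 * 10 ^+ 3))) / 4 ^+ Delta.
  rewrite /shift_const expr_div_n -expRM_natl; congr (expR _ / _); first by field.
  by rewrite -exprM mulnC exprM; congr (_ ^+ _); ring.
rewrite ler_pM2r ?invr_gt0 ?exprn_gt0//.
rewrite /ek /ef -!expRM_natl -expRD ler_expR natrM.
have -> : (s.*2)%:R = 2 * s%:R :> R by rewrite -mul2n natrM.
have -> : Delta.-1%:R = Delta%:R - 1 :> R by rewrite -[in RHS](ltn_predK hDelta) -natr1 addrK.
have w0 : 0 < w by apply: lt_le_trans hw; rewrite exprn_gt0.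
have D0 : 0 < Delta%:R :> R by move: D3; lra.
have D2 : 0 < Delta%:R - 2 :> R by move: D3; lra.
set T := (2 * s%:R) ^+ 2.
(* Criticality: the second-order terms of the vertex and the edge factorials agree
   to within [T / (m (m + 1))]. *)
have TD : Delta%:R * (T * (4 * (g + 1) / (g * w ^+ 2))) = 8 * (Delta%:R - 1) * T / w ^+ 2.
  by rewrite /g; field; rewrite !lt0r_neq0// subr_gt0; move: D2; lra.
have w2 : 0 < w ^+ 2 by rewrite exprn_gt0.
have w21 : 0 < w ^+ 2 + 1 by rewrite addr_gt0.
have Tw : T / (w ^+ 2 * (w ^+ 2 + 1)) <= 1 / 8.
  rewrite ler_pdivrMr ?mulr_gt0//.
  have w3 : 0 <= w ^+ 3 by rewrite exprn_ge0// ltW.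
  have := ler_wpM2r w3 hw; rewrite /T exprMn; lra.
have D1 : 0 <= Delta%:R - 1 :> R by move: D3; lra.
have := ler_wpM2l D1 Tw.
have -> : (Delta%:R - 1) * (T / (w ^+ 2 * (w ^+ 2 + 1))) =
   (Delta%:R - 1) * T / w ^+ 2 - (Delta%:R - 1) * T / (w ^+ 2 + 1).
  by field; rewrite !lt0r_neq0.
rewrite mulrN [Delta%:R * (T * _ + _)]mulrDr TD mw.
lra.
Qed.

(** Pairs with large [v] contribute to the second moment directly, and those with large [d] do so
    through the correlation hypothesis. The core, where both are small, is pushed outwards by the
    shift, which moves a fixed fraction of its mass to large [v]. *)
Lemma class_weight_second_moment (w : R) (m : nat) :
  40 ^+ 2 <= w -> m%:R = w ^+ 2 ->
  0 <= \sum_(p : 'I_m.+1 * 'I_m.+1)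
    class_weight m p.1 p.2 * ((2 * p.1%:R - m%:R) * (2 * p.2%:R - m%:R)) ->
  w ^+ 3 * (\sum_(p : 'I_m.+1 * 'I_m.+1) class_weight m p.1 p.2) <=
  8 * (1 + shift_const^-1) * (\sum_(p : 'I_m.+1 * 'I_m.+1)
    class_weight m p.1 p.2 * (p.1%:R + p.2%:R - m%:R) ^+ 2).
Proof.
move=> hw mw corr.
pose W (p : 'I_m.+1 * 'I_m.+1) := class_weight m p.1 p.2.
pose v (p : 'I_m.+1 * 'I_m.+1) : R := p.1%:R + p.2%:R - m%:R.
pose d (p : 'I_m.+1 * 'I_m.+1) : R := p.1%:R - p.2%:R.
have W0 p : 0 <= W p by exact: class_weight_ge0.
have w0 : 0 < w by apply: lt_le_trans hw; rewrite exprn_gt0.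
have w3 : 1 <= w ^+ 3.
  by apply: exprn_ege1; apply: le_trans hw; apply: exprn_ege1; lra.
(* The integer part of [m^(3/4)]: rounding down keeps [s^2 <= w^3] and loses at most a factor [4] in
   the other direction. *)
pose s := Num.truncn (Num.sqrt (w ^+ 3)).
have sqrt0 : 0 <= Num.sqrt (w ^+ 3) by exact: sqrtr_ge0.
have sqrtE : Num.sqrt (w ^+ 3) ^+ 2 = w ^+ 3 by rewrite sqr_sqrtr//; lra.
have [s1 s2] := andP (truncn_itv sqrt0); rewrite -/s in s1 s2.
have s_ge1 : 1 <= s%:R :> R.
  have sqrt1 : 1 <= Num.sqrt (w ^+ 3) by rewrite -[leLHS]sqrtr1 ler_sqrt//; lra.
  by rewrite ler1n; move: (le_lt_trans sqrt1 s2); rewrite ltr1n.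
have sw : s%:R ^+ 2 <= w ^+ 3 by rewrite -sqrtE ler_sqr ?nnegrE.
have ws : w ^+ 3 <= 4 * s%:R ^+ 2.
  rewrite -sqrtE; apply: le_trans (_ : (2 * s%:R) ^+ 2 <= _); last by rewrite exprMn; lra.
  by rewrite ler_sqr ?nnegrE ?mulr_ge0//; move: s2; rewrite -natr1; lra.
have sm : 40 * s%:R <= m%:R :> R.
  rewrite -ler_sqr ?nnegrE ?mulr_ge0// mw exprMn -exprM.
  have := ler_wpM2r (ltW (lt_le_trans ltr01 w3)) hw.
  have := ler_wpM2l (sqr_ge0 (40 : R)) sw.
  by rewrite -exprS; lra.
pose core p := (`|v p| <= s%:R) && (`|d p| <= s%:R).
pose far p := s%:R ^+ 2 <= v p ^+ 2.
pose T := \sum_p W p * v p ^+ 2.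
have s20 : 0 < s%:R ^+ 2 :> R by rewrite exprn_gt0//; lra.
have far_le : s%:R ^+ 2 * (\sum_(p | far p) W p) <= T.
  rewrite mulr_sumr [leLHS]big_mkcond; apply: ler_sum => p _.
  case: ifP => [fp|_]; last by rewrite mulr_ge0 ?sqr_ge0.
  by rewrite mulrC ler_wpM2l.
(* The correlation hypothesis in another form, as [v^2 - d^2] is the product of the two
   magnetizations. *)
have dT : \sum_p W p * d p ^+ 2 <= T.
  rewrite -subr_ge0 /T -sumrB; move: corr; congr (0 <= _).
  by apply: eq_bigr => p _; rewrite /W /v /d; ring.
have noncore : s%:R ^+ 2 * (\sum_(p | ~~ core p) W p) <= 2 * T.
  have -> : 2 * T = T + T by ring.
  apply: le_trans (lerD (lexx T) dT); rewrite /T -big_split mulr_sumr [leLHS]big_mkcond /=.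
  apply: ler_sum => p _; rewrite -mulrDr; case: ifP => [|_]; last first.
    by rewrite mulr_ge0 ?addr_ge0 ?sqr_ge0.
  rewrite mulrC => H; apply: ler_wpM2l => //; move: H.
  rewrite negb_and -!ltNge => /orP[] /ltW H.
    apply: le_trans (_ : v p ^+ 2 <= _); last by rewrite lerDl sqr_ge0.
    by rewrite -[leRHS]real_normK ?num_real// ler_sqr ?nnegrE.
  apply: le_trans (_ : d p ^+ 2 <= _); last by rewrite lerDr sqr_ge0.
  by rewrite -[leRHS]real_normK ?num_real// ler_sqr ?nnegrE.
have s2E : (s.*2)%:R = 2 * s%:R :> R by rewrite -mul2n natrM.
have core_bounds p : core p -> [/\ (s.*2 <= p.1)%N, (p.1 + s.*2 <= m)%N,
    (s.*2 <= p.2)%N & (p.2 + s.*2 <= m)%N].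
  rewrite /core !ler_norml /v /d => /andP[/andP[v1 v2] /andP[d1 d2]].
  by split; rewrite -(ler_nat R) ?natrD s2E; lra.
pose up (p : 'I_m.+1 * 'I_m.+1) : 'I_m.+1 * 'I_m.+1 :=
  (inord (p.1 + s.*2), inord (p.2 + s.*2)).
pose dn (p : 'I_m.+1 * 'I_m.+1) : 'I_m.+1 * 'I_m.+1 :=
  (inord (p.1 - s.*2), inord (p.2 - s.*2)).
have upE p : core p -> (up p).1 = (p.1 + s.*2)%N :> nat /\ (up p).2 = (p.2 + s.*2)%N :> nat.
  by move=> /core_bounds[_ ? _ ?]; rewrite /up /= !inordK.
have dnE p : (dn p).1 = (p.1 - s.*2)%N :> nat /\ (dn p).2 = (p.2 - s.*2)%N :> nat.
  rewrite /dn /= !inordK// ltnS (leq_trans (leq_subr _ _))// -ltnS; exact: ltn_ord.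
(* Shifting both sizes by [2 s] moves [v] by [4 s], which takes every core pair out to [far]. *)
have far_sqr p x : `|v p| <= s%:R -> x = v p + 4 * s%:R \/ x = v p - 4 * s%:R -> s%:R ^+ 2 <= x ^+ 2.
  rewrite ler_norml => /andP[v1 v2] xE.
  rewrite -[leRHS]real_normK ?num_real// ler_sqr ?nnegrE//.
  by case: xE => ->; rewrite ler_normr; apply/orP; [left|right]; lra.
have up_le : \sum_(p | core p) W (up p) <= \sum_(p | far p) W p.
  apply: ler_sum_inj => //.
  - move=> [a b] [a' b'] /upE/=[a1 b1] /upE/=[a1' b1'] [/(congr1 (@nat_of_ord _)) E1 /(congr1 (@nat_of_ord _)) E2].
    rewrite a1 a1' in E1; rewrite b1 b1' in E2.
    by congr pair; apply: val_inj; [exact: addIn E1|exact: addIn E2].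
  - move=> p pc; have /andP[vp _] := pc; apply: far_sqr vp _; left.
    by have [E1 E2] := upE _ pc; rewrite /v E1 E2 !natrD s2E; ring.
have dn_le : \sum_(p | core p) W (dn p) <= \sum_(p | far p) W p.
  apply: ler_sum_inj => //.
  - move=> [a b] [a' b'] /core_bounds/=[ha _ hb _] /core_bounds/=[ha' _ hb' _].
    have /=[a1 b1] := dnE (a, b); have /=[a1' b1'] := dnE (a', b').
    move=> [/(congr1 (@nat_of_ord _)) E1 /(congr1 (@nat_of_ord _)) E2].
    rewrite a1 a1' in E1; rewrite b1 b1' in E2.
    by congr pair; apply: val_inj => /=; [rewrite -(subnK ha) E1 subnK|rewrite -(subnK hb) E2 subnK].
  - move=> p pc; have /andP[vp _] := pc; apply: far_sqr vp _; right.
    have [ha _ hb _] := core_bounds _ pc.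
    by have [E1 E2] := dnE p; rewrite /v E1 E2 !natrB// s2E; ring.
have c0 : 0 < shift_const by rewrite /shift_const divr_gt0 ?expR_gt0 ?exprn_gt0.
have core_le : shift_const * (\sum_(p | core p) W p) <= 2 * (\sum_(p | far p) W p).
  have -> : 2 * (\sum_(p | far p) W p) = \sum_(p | far p) W p + \sum_(p | far p) W p by ring.
  apply: le_trans (lerD up_le dn_le); rewrite -big_split mulr_sumr /=.
  apply: ler_sum => p pc; have /andP[vp dp] := pc.
  have [h1 h2 h3 h4] := core_bounds _ pc; have [u1 u2] := upE _ pc; have [l1 l2] := dnE p.
  rewrite /W u1 u2 l1 l2; exact: (class_weight_shift hw mw sw).
have T0 : 0 <= T by apply: sumr_ge0 => p _; rewrite mulr_ge0 ?sqr_ge0.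
have SE : \sum_p W p = \sum_(p | core p) W p + \sum_(p | ~~ core p) W p.
  by rewrite (bigID core).
change (w ^+ 3 * (\sum_p W p) <= 8 * (1 + shift_const^-1) * T).
have C0 : 0 <= \sum_(p | core p) W p by exact: sumr_ge0.
have N0 : 0 <= \sum_(p | ~~ core p) W p by exact: sumr_ge0.
have {}core_le : \sum_(p | core p) W p <= shift_const^-1 * (2 * (\sum_(p | far p) W p)).
  by rewrite -ler_pdivrMl ?invr_gt0// invrK.
have ci : 0 <= 2 * shift_const^-1 by rewrite mulr_ge0// invr_ge0 ltW.
have h1 := ler_wpM2r (addr_ge0 C0 N0) ws.
have h2 := ler_wpM2l (ltW s20) core_le.
have h3 := ler_wpM2l ci far_le.
rewrite SE; lra.
Qed.

End ClassWeight.

(** * Random perfect matchings *)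

Section PermutationSum.
Variables (R : realType) (q : R) (n : nat).

Definition disagree (pi : 'S_n) (A B : {set 'I_n}) : nat :=
  #|[set i | (i \in A) != (pi i \in B)]|.

Definition perm_sum (A B : {set 'I_n}) : R := \sum_(pi : 'S_n) q ^+ disagree pi A B.

(** The indicator tuples of [B] and [C] contain each boolean equally often, so one is a permutation
    of the other. *)
Lemma perm_of_card_eq (B C : {set 'I_n}) : #|B| = #|C| ->
  exists sigma : 'S_n, forall i, (sigma i \in B) = (i \in C).
Proof.
move=> BC; pose tB := [tuple i \in B | i < n]; pose tC := [tuple i \in C | i < n].
have /tuple_permP[p pE] : perm_eq tC tB.
  have cnt (P : pred bool) (D : {set 'I_n}) : count P [tuple i \in D | i < n]
      = (P true * #|D| + P false * (n - #|D|))%N.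
    rewrite -sum1_count /= big_map big_enum_cond /=.
    rewrite (bigID [in D]) /=; congr addn.
      rewrite (eq_bigl (fun i => P true && (i \in D))) => [|i]; last by case: (i \in D); rewrite ?andbF ?andbT.
      by case: (P true); [rewrite mul1n sum1_card | rewrite big_pred0].
    rewrite (eq_bigl (fun i => P false && (i \in ~: D))) => [|i]; last first.
      by rewrite inE; case: (i \in D); rewrite ?andbF ?andbT.
    case: (P false); last by rewrite big_pred0.
    by rewrite mul1n sum1_card cardsCs setCK card_ord.
  by apply/seq.permP => P; rewrite !cnt BC.
exists p => i; have := congr1 (nth false ^~ i) pE.
by rewrite -!tnth_nth !tnth_mktuple.
Qed.

Lemma card_perm_preim (pi : 'S_n) (B : {set 'I_n}) : #|[set i | pi i \in B]| = #|B|.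
Proof.
rewrite -(card_imset [pred i in [set i | pi i \in B]] (@perm_inj _ pi)).
apply: eq_card => j; apply/imsetP/idP => [[k]|jB]; first by rewrite !inE => ? ->.
by exists ((pi^-1)%g j); rewrite ?inE permKV.
Qed.

Definition preim_count (B C : {set 'I_n}) : nat :=
  #|[set pi : 'S_n | [set i | pi i \in B] == C]|.

(** By symmetry the count is the same for every [C] of the size of [B]; these counts add up to
    [n!]. *)
Lemma preim_countE (B C : {set 'I_n}) : #|C| = #|B| ->
  preim_count B C = (factorial #|B| * factorial (n - #|B|))%N.
Proof.
have same (D : {set 'I_n}) : #|D| = #|B| -> preim_count B D = preim_count B B.
  move=> DB; have [sg sgE] := perm_of_card_eq (esym DB).
  rewrite /preim_count -!sum1_card [LHS](reindex_inj (mulgI sg)) /=.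
  apply: eq_bigl => pi; rewrite !inE; apply/eqP/eqP => /setP E; apply/setP => i.
    have := E ((sg^-1)%g i); rewrite !inE permM permKV => ->.
    by rewrite -sgE permKV.
  by have := E (sg i); rewrite !inE permM sgE => ->.
have tot : (\sum_(D : {set 'I_n} | #|D| == #|B|) preim_count B D = n`!)%N.
  rewrite -(card_Sn n) -[in RHS]sum1_card (partition_big (fun pi : 'S_n => [set i | pi i \in B])
    (fun D => #|D| == #|B|)) /=; last first.
    by move=> pi _; rewrite card_perm_preim.
  by apply: eq_bigr => D _; rewrite /preim_count -sum1_card; apply: eq_bigl => pi; rewrite inE.
have Bn : (#|B| <= n)%N by rewrite -[X in (_ <= X)%N]card_ord max_card.
move=> /same ->; apply/eqP; rewrite -(@eqn_pmul2l 'C(n, #|B|)) ?bin_gt0//.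
rewrite bin_fact// -tot (eq_bigr (fun=> preim_count B B)) => [|D /eqP]; last exact: same.
by rewrite sum_nat_const -{1}[n]card_ord -card_draws cardsE.
Qed.

Lemma card_draws_inter (A : {set 'I_n}) (l a : nat) : (a <= l)%N ->
  #|[set C : {set 'I_n} | (#|C| == l) && (#|C :&: A| == a)]| =
  ('C(#|A|, a) * 'C(n - #|A|, l - a))%N.
Proof.
move=> al; rewrite -cards_draws.
have -> : (n - #|A| = #|~: A|)%N by rewrite [in RHS]cardsCs setCK card_ord.
rewrite -cards_draws -cardsX.
rewrite -(card_in_imset (f := fun p : {set 'I_n} * {set 'I_n} => p.1 :|: p.2)); last first.
  move=> [C1 C2] [D1 D2]; rewrite !inE /= => /andP[/andP[C1A _] /andP[C2A _]].
  move=> /andP[/andP[D1A _] /andP[D2A _]] E.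
  have inA (X Y : {set 'I_n}) : X \subset A -> Y \subset ~: A -> (X :|: Y) :&: A = X.
    move=> XA YA; rewrite setIUl (setIidPl XA).
    by rewrite (disjoint_setI0 _) ?setU0// disjoints_subset.
  have outA (X Y : {set 'I_n}) : X \subset A -> Y \subset ~: A -> (X :|: Y) :&: ~: A = Y.
    move=> XA YA; rewrite setIUl (setIidPl YA).
    by rewrite (disjoint_setI0 _) ?set0U// disjoints_subset setCK.
  by congr pair; [rewrite -(inA C1 C2)// E inA|rewrite -(outA C1 C2)// E outA].
apply: eq_card => C; rewrite !inE; apply/andP/imsetP => [[/eqP Cl /eqP Ca]|[[C1 C2]]].
  exists (C :&: A, C :&: ~: A); last by rewrite -setIUr setUCr setIT.
  rewrite !inE /= !subsetIr Ca eqxx /=.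
  by rewrite -setDE; have := cardsID A C; rewrite Ca Cl => <-; rewrite addKn.
rewrite !inE /= => /andP[/andP[C1A /eqP C1a] /andP[C2A /eqP C2l]] ->.
have d : [disjoint C1 & C2].
  by rewrite disjoint_sym disjoints_subset (fintype.subset_trans C2A)// setCS.
rewrite cardsU (disjoint_setI0 d) cards0 subn0 C1a C2l subnKC// eqxx; split=> //.
rewrite setIUl (setIidPl C1A) (disjoint_setI0 _) ?setU0 ?C1a//.
by rewrite disjoints_subset.
Qed.

Lemma sum_draws_sym_diff (A : {set 'I_n}) (l : nat) :
  \sum_(C : {set 'I_n} | #|C| == l) q ^+ #|[set i | (i \in A) != (i \in C)]| =
  \sum_(a < n.+1 | (a <= l)%N)
    ('C(#|A|, a) * 'C(n - #|A|, l - a))%:R * q ^+ ((#|A| - a) + (l - a)).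
Proof.
have cn (D : {set 'I_n}) : (#|D| <= n)%N by rewrite -[X in (_ <= X)%N]card_ord max_card.
rewrite (partition_big (fun C : {set 'I_n} => inord #|C :&: A| : 'I_n.+1)
   (fun a => a <= l)%N) /=; last first.
  by move=> C /eqP <-; rewrite inordK ?ltnS ?cn// subset_leq_card// subsetIl.
apply: eq_bigr => a al.
rewrite (eq_bigl (fun C => C \in [set C : {set 'I_n} | (#|C| == l) && (#|C :&: A| == a)])); last first.
  by move=> C; rewrite inE -val_eqE /= inordK ?ltnS ?cn.
rewrite (eq_bigr (fun=> q ^+ ((#|A| - a) + (l - a)))); last first.
  move=> C; rewrite inE => /andP[/eqP Cl /eqP Ca]; congr (_ ^+ _).
  have -> : [set i | (i \in A) != (i \in C)] = (A :\: C) :|: (C :\: A).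
    by apply/setP => i; rewrite !inE; case: (i \in A); case: (i \in C).
  rewrite cardsU (_ : _ :&: _ = set0) ?cards0 ?subn0.
    by rewrite !cardsD Ca Cl setIC Ca.
  by apply/setP => i; rewrite !inE; case: (i \in A); case: (i \in C).
by rewrite sumr_const card_draws_inter// mulr_natl.
Qed.

(** A matching enters only through the preimage of [B], a uniform set of size [#|B|]. Sorting these
    sets by their intersection with [A] gives two binomials, whose factorials combine into
    [overlap_term]. *)
Lemma perm_sumE (A B : {set 'I_n}) :
  perm_sum A B = classes_fact R n #|A| * classes_fact R n #|B| * overlap_sum q n #|A| #|B|.
Proof.
have cn (D : {set 'I_n}) : (#|D| <= n)%N by rewrite -[X in (_ <= X)%N]card_ord max_card.
rewrite /perm_sum (partition_big (fun pi : 'S_n => [set i | pi i \in B])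
    (fun D => #|D| == #|B|)) /=; last first.
  by move=> pi _; rewrite card_perm_preim.
transitivity (\sum_(C : {set 'I_n} | #|C| == #|B|)
    classes_fact R n #|B| * q ^+ #|[set i | (i \in A) != (i \in C)]|).
  apply: eq_bigr => C /eqP CB.
  rewrite (eq_bigr (fun=> q ^+ #|[set i | (i \in A) != (i \in C)]|)); last first.
    move=> pi /eqP <-; congr (_ ^+ _); apply: eq_card => i; by rewrite !inE.
  rewrite sumr_const -mulr_natl; congr (_ * _).
  by rewrite /classes_fact /factR -natrM -(preim_countE CB) /preim_count cardsE.
rewrite -mulr_sumr sum_draws_sym_diff.
rewrite /overlap_sum !mulr_sumr big_mkcond; apply: eq_bigr => a _.
rewrite /overlap_term; case: (leqP a #|B|) => [al|_]; last by rewrite andbF mulr0.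
case: (leqP a #|A|) => [ak|ak] /=; last by rewrite bin_small// mul0n mul0r !mulr0.
have kn := cn A; case: ifP => [kl|/negbT]; last first.
  rewrite -ltnNge => kl; have -> : 'C(n - #|A|, #|B| - a) = 0%N.
    have aux x y z : (x <= n)%N -> (n + z < x + y)%N -> (n - x < y - z)%N by lia.
    exact/bin_small/aux.
  by rewrite muln0 mul0r !mulr0.
have f0 j : factR R j != 0 by rewrite lt0r_neq0 ?factR_gt0.
have aux x y z : (x <= n)%N -> (z <= y)%N -> (x + y <= n + z)%N ->
    (y - z <= n - x)%N /\ (n - x - (y - z) = n + z - (x + y))%N by lia.
have [lk dE] := aux _ _ _ kn al kl.
have E1 := bin_fact ak; have E2 := bin_fact lk.
rewrite /classes_fact natrM /factR -E1 -E2 !natrM.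
rewrite dE.
by field; rewrite -/(factR R _) !f0.
Qed.

Lemma sum_sets_card (f : nat -> R) :
  \sum_(A : {set 'I_n}) f #|A| = \sum_(k < n.+1) ('C(n, k))%:R * f k.
Proof.
rewrite (partition_big (fun A : {set 'I_n} => inord #|A| : 'I_n.+1) xpredT) //=.
apply: eq_bigr => k _.
rewrite (eq_bigl (fun A => A \in [set A : {set 'I_n} | #|A| == k])); last first.
  move=> A; rewrite inE -val_eqE /= inordK// ltnS.
  by rewrite -[X in (_ <= X)%N]card_ord max_card.
rewrite (eq_bigr (fun=> f k)) => [|A]; last by rewrite inE => /eqP ->.
by rewrite sumr_const card_draws card_ord mulr_natl.
Qed.

End PermutationSum.

(** * Griffiths' inequality *)

Section Griffiths.
Variables (R : realType) (n : nat).
Let T := ({set 'I_n} * {set 'I_n})%type.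

Definition sym_diff (A C : {set 'I_n}) : {set 'I_n} := [set i | (i \in A) != (i \in C)].

Definition sign_of (A : {set 'I_n}) (i : 'I_n) : R := (-1) ^+ (i \in A).

Lemma sign_of_sym_diff A C i : sign_of (sym_diff A C) i = sign_of A i * sign_of C i.
Proof.
rewrite /sign_of inE; case: (i \in A); case: (i \in C) => /=;
  by rewrite ?expr0 ?expr1 ?mulr1 ?mul1r ?mulrNN ?mulr1.
Qed.

(** Multiplicativity on the group of pairs of sets under symmetric difference, where products of
    spins are characters. *)
Definition is_character (chi : T -> R) : Prop :=
  forall x y, chi (sym_diff x.1 y.1, sym_diff x.2 y.2) = chi x * chi y.

Lemma is_characterM (chi psi : T -> R) :
  is_character chi -> is_character psi -> is_character (fun x => chi x * psi x).
Proof. by move=> hc hp x y; rewrite hc hp mulrACA. Qed.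

(* [\sum_x chi x = chi y * \sum_x chi x] for every [y], so the sum vanishes unless
   [chi] is constantly [1]. *)
Lemma sum_character_ge0 (chi : T -> R) : is_character chi -> 0 <= \sum_x chi x.
Proof.
move=> hchi; set S := \sum_x chi x.
have inv (y : T) : involutive (fun x : T => (sym_diff x.1 y.1, sym_diff x.2 y.2)).
  move=> [A B] /=; congr pair; apply/setP => i; rewrite !inE.
    by case: (i \in A); case: (i \in y.1).
  by case: (i \in B); case: (i \in y.2).
have SE y : S = S * chi y.
  rewrite {1}/S (reindex_inj (inv_inj (inv y))) mulr_suml.
  by apply: eq_bigr => x _; rewrite hchi.
have [->//|S0] := eqVneq S 0.
apply: sumr_ge0 => x _.
have -> : chi x = 1 by apply: (mulfI S0); rewrite -SE mulr1.
exact: ler01.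
Qed.

(** Expanding the product leaves nonnegative multiples of sums of characters. The extra character
    [chi0] collects the factors already expanded. *)
Lemma griffiths_ge0 (I : Type) (r : seq I) (chi : I -> T -> R) (al ga : R) (chi0 : T -> R) :
  0 <= al -> 0 <= ga -> (forall i, is_character (chi i)) -> is_character chi0 ->
  0 <= \sum_x (\prod_(i <- r) (al + ga * chi i x)) * chi0 x.
Proof.
move=> al0 ga0 hchi; elim: r chi0 => [|i r IH] chi0 h0.
  under eq_bigr do rewrite big_nil mul1r.
  exact: sum_character_ge0.
have -> : \sum_x (\prod_(j <- i :: r) (al + ga * chi j x)) * chi0 x =
   al * (\sum_x (\prod_(j <- r) (al + ga * chi j x)) * chi0 x) +
   ga * (\sum_x (\prod_(j <- r) (al + ga * chi j x)) * (chi i x * chi0 x)).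
  rewrite !mulr_sumr -big_split; apply: eq_bigr => x _ /=; rewrite big_cons; ring.
by rewrite addr_ge0// mulr_ge0// IH//; exact: is_characterM.
Qed.

End Griffiths.

(** * Families of matchings: correlations and repeated edges *)

Section Matchings.
Variables (R : realType) (q : R) (n Delta : nat).
Hypotheses (q_gt0 : 0 < q) (q_le1 : q <= 1).

Let family := {ffun 'I_Delta -> 'S_n}.

Definition matching_weight (G : family) (A B : {set 'I_n}) : R :=
  \prod_t q ^+ disagree (G t) A B.

Lemma matching_weight_gt0 G A B : 0 < matching_weight G A B.
Proof. by apply: prodr_gt0 => t _; exact: exprn_gt0. Qed.

Lemma sum_matching_weight A B :
  \sum_G matching_weight G A B = perm_sum q A B ^+ Delta.
Proof.
rewrite /matching_weight -(bigA_distr_bigA (fun _ pi => q ^+ disagree pi A B)) /=.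
by rewrite prodr_const card_ord.
Qed.

(** The high-temperature form of each edge factor, which is [1] or [q] according to the sign; for
    [0 < q <= 1] both coefficients are nonnegative, as Griffiths' inequality requires. *)
Lemma matching_weightE G A B : matching_weight G A B =
  \prod_(p : 'I_Delta * 'I_n)
    ((1 + q) / 2 + (1 - q) / 2 * (sign_of R A p.2 * sign_of R B (G p.1 p.2))).
Proof.
rewrite /matching_weight.
rewrite -(pair_bigA _ (fun t i => (1 + q) / 2 + (1 - q) / 2 * (sign_of R A i * sign_of R B (G t i)))) /=.
apply: eq_bigr => t _; rewrite /disagree -prodr_const big_mkcond.
apply: eq_bigr => i _; rewrite inE /sign_of.
by case: (i \in A); case: (G t i \in B) => /=; rewrite ?expr0 ?expr1; field.
Qed.

Lemma sum_sign_of (A : {set 'I_n}) : \sum_i sign_of R A i = n%:R - 2 * #|A|%:R.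
Proof.
have -> : n%:R = \sum_(i < n) (1 : R) by rewrite sumr_const card_ord.
rewrite -sum1_card natr_sum mulr_sumr [X in _ - X]big_mkcond -sumrB.
by apply: eq_bigr => i _; rewrite /sign_of; case: (i \in A); rewrite ?expr0 ?expr1; ring.
Qed.

Lemma matching_weight_correlation_ge0 G :
  0 <= \sum_(x : {set 'I_n} * {set 'I_n}) matching_weight G x.1 x.2 *
    ((2 * #|x.1|%:R - n%:R) * (2 * #|x.2|%:R - n%:R)).
Proof.
have -> : \sum_(x : {set 'I_n} * {set 'I_n}) matching_weight G x.1 x.2 *
    ((2 * #|x.1|%:R - n%:R) * (2 * #|x.2|%:R - n%:R)) =
   \sum_(i < n) \sum_(j < n) \sum_(x : {set 'I_n} * {set 'I_n})
     matching_weight G x.1 x.2 * (sign_of R x.1 i * sign_of R x.2 j).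
  under [RHS]eq_bigr do rewrite exchange_big /=.
  rewrite [RHS]exchange_big /=; apply: eq_bigr => x _.
  under [RHS]eq_bigr do rewrite -mulr_sumr -mulr_sumr.
  rewrite -mulr_sumr -mulr_suml !sum_sign_of; congr (_ * _); ring.
apply: sumr_ge0 => i _; apply: sumr_ge0 => j _.
under eq_bigr do rewrite matching_weightE.
have ch k l : is_character (fun x : {set 'I_n} * {set 'I_n} => sign_of R x.1 k * sign_of R x.2 l).
  by move=> x y; rewrite !sign_of_sym_diff mulrACA.
apply: (@griffiths_ge0 _ _ _ _ (fun (p : 'I_Delta * 'I_n) (x : {set 'I_n} * {set 'I_n}) =>
  sign_of R x.1 p.2 * sign_of R x.2 (G p.1 p.2))) => //.
- by rewrite divr_ge0// addr_ge0// ltW.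
- by rewrite divr_ge0// subr_ge0.
Qed.

(** Ordered pairs are counted, so an edge of multiplicity [r] contributes [r (r - 1)], which is at
    least [r - 1]. *)
Definition collisions (G : family) : nat :=
  \sum_(t < Delta) \sum_(t' < Delta | t' != t) #|[set i | G t i == G t' i]|.

Definition pinned_sum (A B : {set 'I_n}) (i j : 'I_n) : R :=
  \sum_(pi : 'S_n | pi i == j) q ^+ disagree pi A B.

Let dis_ge0 (pi : 'S_n) A B : 0 <= q ^+ disagree pi A B. Proof. by rewrite exprn_ge0// ltW. Qed.

Lemma pinned_sum_ge0 A B i j : 0 <= pinned_sum A B i j.
Proof. exact: sumr_ge0. Qed.

Lemma sum_pinned_sum_source A B j : \sum_i pinned_sum A B i j = perm_sum q A B.
Proof.
rewrite /pinned_sum (exchange_big_dep xpredT) //=; apply: eq_bigr => pi _.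
rewrite (eq_bigl (pred1 ((pi^-1)%g j))) ?big_pred1_eq// => i /=.
by apply/eqP/eqP => [<-|->]; rewrite ?permK ?permKV.
Qed.

Lemma sum_pinned_sum_target A B i : \sum_j pinned_sum A B i j = perm_sum q A B.
Proof.
rewrite /pinned_sum (exchange_big_dep xpredT) //=; apply: eq_bigr => pi _.
by rewrite (eq_bigl (pred1 (pi i))) ?big_pred1_eq// => j /=; rewrite eq_sym.
Qed.

(* Composing with the transposition of [j] and [j'] preserves the weight. *)
Lemma pinned_sum_class A (B : {set 'I_n}) i j j' :
  (j \in B) = (j' \in B) -> pinned_sum A B i j = pinned_sum A B i j'.
Proof.
move=> jj; rewrite /pinned_sum [RHS](reindex_inj (mulIg (tperm j j'))) /=.
apply: eq_big => pi.
  rewrite permM; apply/eqP/eqP => [->|/(canRL (tpermK _ _)) ->]; first by rewrite tpermL.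
  by rewrite tpermR.
move=> _; congr (_ ^+ _); apply: eq_card => k; rewrite !inE permM.
by case: tpermP => // ->; rewrite jj.
Qed.

Lemma pinned_sum_le A (B : {set 'I_n}) i j :
  #|[set j' | (j' \in B) == (j \in B)]|%:R * pinned_sum A B i j <= perm_sum q A B.
Proof.
rewrite -(sum_pinned_sum_target A B i) mulr_natl -sumr_const big_mkcond.
apply: ler_sum => k _; rewrite inE; case: eqP => [jk|_]; last exact: pinned_sum_ge0.
by rewrite (pinned_sum_class _ _ jk).
Qed.

(** Each of the two classes, [B] and its complement, contributes [1], or [0] if it is empty. *)
Lemma sum_class_inv_le (B : {set 'I_n}) :
  \sum_j #|[set j' | (j' \in B) == (j \in B)]|%:R^-1 <= 2 :> R.
Proof.
rewrite (bigID [in B]) /=.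
have half (D : {set 'I_n}) : \sum_(j in D) #|D|%:R^-1 <= 1 :> R.
  rewrite sumr_const -[leLHS]mulr_natl.
  by have [->|D0] := eqVneq (#|D|%:R : R) 0; rewrite ?mul0r ?divff ?ler01.
have -> : 2%:R = 1 + 1 :> R by ring.
apply: lerD.
  apply: le_trans (half B); apply: ler_sum => j jB; rewrite jB le_eqVlt; apply/orP; left.
  by apply/eqP; congr (_%:R^-1); apply: eq_card => k; rewrite inE eqb_id.
rewrite (eq_bigl [in ~: B]) => [|j]; last by rewrite inE.
apply: le_trans (half (~: B)); apply: ler_sum => j; rewrite inE => /negPf jB.
rewrite jB le_eqVlt; apply/orP; left.
by apply/eqP; congr (_%:R^-1); apply: eq_card => k; rewrite !inE eqbF_neg.
Qed.

(** After normalization, the expected number of common edges of two independent matchings: one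
    factor is bounded by the inverse of the class size of [j], the other sums to [1] over [i]. *)
Lemma sum_sqr_pinned_sum_le A B :
  \sum_j \sum_i pinned_sum A B i j ^+ 2 <= 2 * perm_sum q A B ^+ 2.
Proof.
have P0 : 0 <= perm_sum q A B by exact: sumr_ge0.
pose c (j : 'I_n) : R := #|[set j' | (j' \in B) == (j \in B)]|%:R.
have c0 j : 0 < c j by rewrite /c ltr0n card_gt0; apply/set0Pn; exists j; rewrite inE.
apply: le_trans (_ : \sum_j (c j)^-1 * perm_sum q A B ^+ 2 <= _); last first.
  by rewrite -mulr_suml ler_wpM2r ?sqr_ge0// sum_class_inv_le.
apply: ler_sum => j _.
rewrite expr2 mulrA -{2}(sum_pinned_sum_source A B j) mulr_sumr.
apply: ler_sum => i _; rewrite expr2; apply: ler_wpM2r; first exact: pinned_sum_ge0.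
by rewrite ler_pdivlMl// pinned_sum_le.
Qed.

(** Given the spins the matchings are independent, so the sum over families factors and only [t] and
    [t'] are pinned. *)
Lemma sum_pair_collisions_le (t t' : 'I_Delta) A B : t' != t ->
  \sum_(G : family) #|[set i | G t i == G t' i]|%:R * matching_weight G A B <=
  2 * \sum_(G : family) matching_weight G A B.
Proof.
move=> tt'.
pose f i j (s : 'I_Delta) (pi : 'S_n) : R :=
  if (s == t) || (s == t') then (if pi i == j then q ^+ disagree pi A B else 0)
  else q ^+ disagree pi A B.
have E (G : family) : #|[set i | G t i == G t' i]|%:R * matching_weight G A B =
    \sum_j \sum_i \prod_s f i j s (G s).
  rewrite exchange_big /= -sum1_card natr_sum mulr_suml big_mkcond; apply: eq_bigr => i _ /=.
  rewrite inE (bigD1 (G t i)) //= [X in _ + X]big1 ?addr0 => [|j jt]; last first.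
    by rewrite (bigD1 t)//= /f eqxx /= eq_sym (negPf jt) mul0r.
  case: eqP => [tE|/eqP tE]; last first.
    by rewrite (bigD1 t')//= /f eqxx orbT eq_sym (negPf tE) mul0r.
  rewrite mul1r /matching_weight; apply: eq_bigr => s _; rewrite /f.
  case: eqVneq => [->|_] /=; first by rewrite eqxx.
  by case: eqVneq => [->|_] //=; rewrite tE eqxx.
under eq_bigr do rewrite E.
rewrite exchange_big /=; under eq_bigr do rewrite exchange_big /=.
pose P : R := \prod_(s < Delta | (s != t) && (s != t')) perm_sum q A B.
have PE : \sum_(G : family) matching_weight G A B = perm_sum q A B ^+ 2 * P.
  rewrite sum_matching_weight -{1}(card_ord Delta) -prodr_const (bigD1 t)//= (bigD1 t')//=.
  by rewrite mulrA -expr2.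
have P0 : 0 <= P by apply: prodr_ge0 => s _; exact: sumr_ge0.
rewrite PE mulrA.
apply: le_trans (ler_wpM2r P0 (sum_sqr_pinned_sum_le A B)).
rewrite mulr_suml; apply: ler_sum => j _; rewrite mulr_suml; apply: ler_sum => i _.
rewrite -(bigA_distr_bigA (f i j)) (bigD1 t)//= (bigD1 t')//= mulrA.
have -> : \sum_pi f i j t pi = pinned_sum A B i j.
  by rewrite /pinned_sum [RHS]big_mkcond; apply: eq_bigr => pi _; rewrite /f eqxx.
have -> : \sum_pi f i j t' pi = pinned_sum A B i j.
  by rewrite /pinned_sum [RHS]big_mkcond; apply: eq_bigr => pi _; rewrite /f eqxx orbT.
rewrite -expr2 le_eqVlt; apply/orP; left; apply/eqP; congr (_ * _).
by apply: eq_bigr => s /andP[/negPf st /negPf st']; apply: eq_bigr => pi _; rewrite /f st st'.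
Qed.

Lemma sum_collisions_le A B :
  \sum_(G : family) (collisions G)%:R * matching_weight G A B <=
  2 * Delta%:R ^+ 2 * \sum_(G : family) matching_weight G A B.
Proof.
set Z := \sum_(G : family) matching_weight G A B.
have Z0 : 0 <= Z by apply: sumr_ge0 => G _; rewrite ltW// matching_weight_gt0.
have -> : \sum_(G : family) (collisions G)%:R * matching_weight G A B =
    \sum_(t < Delta) \sum_(t' < Delta | t' != t)
       \sum_(G : family) #|[set i | G t i == G t' i]|%:R * matching_weight G A B.
  under [RHS]eq_bigr do rewrite exchange_big /=.
  rewrite [RHS]exchange_big /=; apply: eq_bigr => G _.
  rewrite /collisions natr_sum mulr_suml; apply: eq_bigr => t _.
  by rewrite natr_sum mulr_suml.
have -> : 2 * Delta%:R ^+ 2 * Z = \sum_(t < Delta) \sum_(t' < Delta) 2 * Z.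
  by rewrite !sumr_const !card_ord -mulrnA -[RHS]mulr_natl natrM; ring.
apply: ler_sum => t _; rewrite big_mkcond; apply: ler_sum => t' _.
by case: ifP => [tt'|_]; [exact: sum_pair_collisions_le|rewrite mulr_ge0].
Qed.

(* Disagreeing edges of the simple graph, counted without multiplicity. *)
Definition graph_disagree (G : family) (A B : {set 'I_n}) : nat :=
  #|[set p : 'I_n * 'I_n | [exists t, G t p.1 == p.2] && ((p.1 \in A) != (p.2 \in B))]|.

(** An edge of multiplicity [r >= 1] counts once on the left and [r] times in the middle, and
    [r <= 1 + r (r - 1)]. *)
Lemma graph_disagree_bounds G A B :
  (graph_disagree G A B <= \sum_t disagree (G t) A B <= graph_disagree G A B + collisions G)%N.
Proof.
have E1 : (\sum_t disagree (G t) A B)%N =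
   (\sum_(p : 'I_n * 'I_n | (p.1 \in A) != (p.2 \in B)) #|[set t | G t p.1 == p.2]|)%N.
  under [RHS]eq_bigr do rewrite -sum1_card.
  rewrite (exchange_big_dep xpredT) //=; apply: eq_bigr => t _.
  rewrite /disagree -sum1_card.
  rewrite (reindex_onto (fun i => (i, G t i)) fst) /=; last first.
    by move=> [i j] /=; rewrite inE /= => /andP[_ /eqP ->].
  by apply: eq_bigl => i; rewrite !inE !eqxx !andbT.
have E2 : graph_disagree G A B = (\sum_(p : 'I_n * 'I_n | (p.1 \in A) != (p.2 \in B))
    [exists t, G t p.1 == p.2])%N.
  rewrite /graph_disagree -sum1_card big_mkcond [RHS]big_mkcond; apply: eq_bigr => p _.
  by rewrite inE; case: ([exists t, _]); case: (_ != _).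
have E3 : (\sum_(p : 'I_n * 'I_n) \sum_(t | G t p.1 == p.2) \sum_(t' | (t' != t) && (G t' p.1 == p.2)) 1
   <= collisions G)%N.
  rewrite /collisions; apply/eq_leq.
  rewrite (exchange_big_dep xpredT) //=; apply: eq_bigr => t _.
  rewrite (exchange_big_dep (fun t' => t' != t)) /=; last by move=> ? ? _ /andP[].
  apply: eq_bigr => t' tt'; rewrite -sum1_card.
  rewrite (reindex_onto (fun i => (i, G t i)) fst) /=; last first.
    by move=> [i j] /= /and3P[/eqP -> _ _].
  by apply: eq_bigl => i; rewrite !inE !eqxx tt' /= andbT eq_sym.
rewrite E1 E2; apply/andP; split.
  apply: leq_sum => p _; case: existsP => // -[t tp].
  by rewrite card_gt0; apply/set0Pn; exists t; rewrite inE.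
apply: leq_trans (leq_add (leqnn _) E3).
rewrite [X in (_ <= _ + X)%N](bigID (fun p => (p.1 \in A) != (p.2 \in B))) /=.
apply: leq_trans (leq_add (leqnn _) (leq_addr _ _)).
rewrite -big_split /=; apply: leq_sum => p _.
case: existsP => [[t tp]|H]; last first.
  rewrite (_ : [set t | _] = set0) ?cards0//.
  by apply/setP => t; rewrite !inE; apply/negbTE/negP => tp; case: H; exists t.
rewrite (bigD1 t)//= -sum1_card (bigD1 t) ?inE//= leq_add2l.
apply: leq_trans (leq_addr _ _); rewrite leq_eqVlt; apply/orP; left; apply/eqP.
by apply: eq_bigl => t'; rewrite inE andbC.
Qed.

End Matchings.

(** * Choice of the matchings by an annealed average *)

Section Annealed.
Variables (R : realType) (n Delta : nat).
Hypothesis hDelta : (3 <= Delta)%N.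

Let q : R := (Delta%:R - 2) / Delta%:R.
Let family := {ffun 'I_Delta -> 'S_n}.
Let T := ({set 'I_n} * {set 'I_n})%type.

Let D3 : 3 <= Delta%:R :> R. Proof. by rewrite ler_nat. Qed.
Let q_gt0 : 0 < q. Proof. by rewrite /q divr_gt0//; move: D3; lra. Qed.
Let q_le1 : q <= 1. Proof. by rewrite /q ler_pdivrMr; move: D3; lra. Qed.

Lemma sum_perm_sum_exp (h : nat -> nat -> R) :
  \sum_(x : T) perm_sum q x.1 x.2 ^+ Delta * h #|x.1| #|x.2| =
  factR R n ^+ 2 * \sum_(p : 'I_n.+1 * 'I_n.+1) class_weight R Delta n p.1 p.2 * h p.1 p.2.
Proof.
pose f k l : R := (classes_fact R n k * classes_fact R n l * overlap_sum q n k l) ^+ Delta * h k l.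
transitivity (\sum_(A : {set 'I_n}) \sum_(B : {set 'I_n}) f #|A| #|B|).
  by rewrite pair_bigA; apply: eq_bigr => x _; rewrite perm_sumE.
under eq_bigr do rewrite sum_sets_card.
rewrite (sum_sets_card n (fun k => \sum_(l < n.+1) 'C(n, l)%:R * f k l)).
rewrite -(pair_bigA _ (fun k l : 'I_n.+1 => class_weight R Delta n k l * h k l)) /= mulr_sumr.
apply: eq_bigr => k _; rewrite !mulr_sumr; apply: eq_bigr => l _.
have bf (j : 'I_n.+1) : 'C(n, j)%:R * classes_fact R n j = factR R n.
  by rewrite /classes_fact /factR -!natrM bin_fact// -ltnS ltn_ord.
have -> : factR R n ^+ 2 = ('C(n, k)%:R * classes_fact R n k) * ('C(n, l)%:R * classes_fact R n l).
  by rewrite !bf.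
rewrite /f /class_weight exprMn -{1}(ltn_predK hDelta) exprS; ring.
Qed.

Lemma exists_matchings_second_moment (w : R) :
  40 ^+ 2 <= w -> n%:R = w ^+ 2 ->
  exists G : family,
    w ^+ 3 * q ^+ (4 * Delta ^ 2) / (16 * (1 + (shift_const R Delta)^-1))
      * (\sum_(x : T) q ^+ graph_disagree G x.1 x.2) <=
    \sum_(x : T) q ^+ graph_disagree G x.1 x.2 * (#|x.1|%:R + #|x.2|%:R - n%:R) ^+ 2.
Proof.
move=> hw nw.
have w3 : 0 < w ^+ 3 by rewrite exprn_gt0// (lt_le_trans _ hw)// exprn_gt0.
have D20 : 0 < Delta%:R ^+ 2 :> R by rewrite exprn_gt0//; move: D3; lra.
have Dn0 : Delta%:R != 0 :> R by rewrite lt0r_neq0//; move: D3; lra.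
pose C : R := 8 * (1 + (shift_const R Delta)^-1).
have C0 : 0 < C.
  have : 0 < shift_const R Delta by rewrite /shift_const divr_gt0 ?expR_gt0 ?exprn_gt0.
  by rewrite -invr_gt0 /C => c0; rewrite mulr_gt0// addr_gt0.
have C20 : 0 < 2 * C by exact: mulr_gt0.
pose mw (G : family) (x : T) : R := matching_weight q G x.1 x.2.
pose S (x : T) : R := (#|x.1|%:R + #|x.2|%:R - n%:R) ^+ 2.
have S0 x : 0 <= S x by exact: sqr_ge0.
have mw0 G x : 0 < mw G x by exact: matching_weight_gt0.
pose Z := \sum_G \sum_x mw G x; pose M := \sum_G \sum_x mw G x * S x.
have link (h : nat -> nat -> R) : \sum_(G : family) \sum_x mw G x * h #|x.1| #|x.2| =
   factR R n ^+ 2 * \sum_(p : 'I_n.+1 * 'I_n.+1) class_weight R Delta n p.1 p.2 * h p.1 p.2.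
  rewrite -sum_perm_sum_exp exchange_big /=; apply: eq_bigr => x _.
  by rewrite -mulr_suml sum_matching_weight.
have f0 : 0 < factR R n ^+ 2 by rewrite exprn_gt0// factR_gt0.
have ZM : w ^+ 3 * Z <= C * M.
  have corr : 0 <= \sum_(p : 'I_n.+1 * 'I_n.+1) class_weight R Delta n p.1 p.2 *
      ((2 * p.1%:R - n%:R) * (2 * p.2%:R - n%:R)).
    rewrite -(pmulr_rge0 _ f0) -(link (fun k l => (2 * k%:R - n%:R) * (2 * l%:R - n%:R))).
    by apply: sumr_ge0 => G _; exact: matching_weight_correlation_ge0.
  have H := class_weight_second_moment hDelta hw nw corr.
  have ZE : Z = factR R n ^+ 2 * \sum_(p : 'I_n.+1 * 'I_n.+1) class_weight R Delta n p.1 p.2.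
    rewrite /Z; under eq_bigr do under eq_bigr do rewrite -[mw _ _]mulr1.
    by rewrite (link (fun _ _ => 1)); congr (_ * _); apply: eq_bigr => p _; rewrite mulr1.
  rewrite ZE /M /S (link (fun k l => (k%:R + l%:R - n%:R) ^+ 2)).
  by rewrite [leLHS]mulrCA [leRHS]mulrCA ler_pM2l.
have coll : \sum_(G : family) \sum_x (collisions G)%:R * (mw G x * S x) <= 2 * Delta%:R ^+ 2 * M.
  rewrite /M exchange_big [in leRHS]exchange_big /= mulr_sumr; apply: ler_sum => x _.
  under eq_bigr do rewrite mulrA.
  by rewrite -!mulr_suml mulrA; apply: ler_wpM2r => //; exact: sum_collisions_le.
(* One functional secures both properties: [Phi G] is negative once there are [4 Delta^2]
   collisions, and [0 <= Phi G] forces a large second moment. Its sum over [G] is nonnegative since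
   the penalty takes at most half of [2 C M]. *)
pose Phi (G : family) := \sum_x mw G x * (2 * C * S x * (1 - (collisions G)%:R / (4 * Delta%:R ^+ 2)) - w ^+ 3).
have [G PhiG] : exists G, 0 <= Phi G.
  apply: contrapT => /forallNP H.
  have : \sum_G Phi G < 0.
    have neg G : 0 < - Phi G by rewrite oppr_gt0 ltNge; exact/negP.
    rewrite -oppr_gt0 -sumrN (bigD1 [ffun=> 1%g]) //=; apply: ltr_pwDl => //.
    by apply: sumr_ge0 => G _; exact: ltW.
  apply/negP; rewrite -leNgt.
  have -> : \sum_G Phi G = 2 * C * M - C / (2 * Delta%:R ^+ 2) *
      (\sum_(G : family) \sum_x (collisions G)%:R * (mw G x * S x)) - w ^+ 3 * Z.
    rewrite /M /Z !mulr_sumr -!sumrB; apply: eq_bigr => G _.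
    rewrite /Phi !mulr_sumr -!sumrB; apply: eq_bigr => x _; field; exact: Dn0.
  have c20 : 0 <= C / (2 * Delta%:R ^+ 2) by rewrite ltW// divr_gt0// mulr_gt0.
  have := ler_wpM2l c20 coll.
  have -> : C / (2 * Delta%:R ^+ 2) * (2 * Delta%:R ^+ 2 * M) = C * M.
    by field; exact: Dn0.
  move: ZM; lra.
exists G.
have mwZ : 0 < \sum_x mw G x.
  rewrite (bigD1 (set0, set0)) //=; apply: ltr_pwDl => //.
  by apply: sumr_ge0 => x _; exact: ltW.
have PhiE : Phi G = 2 * C * (1 - (collisions G)%:R / (4 * Delta%:R ^+ 2)) * (\sum_x mw G x * S x)
    - w ^+ 3 * \sum_x mw G x.
  rewrite /Phi !mulr_sumr -sumrB; apply: eq_bigr => x _; ring.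
have MG0 : 0 <= \sum_x mw G x * S x by apply: sumr_ge0 => x _; rewrite mulr_ge0// ltW.
rewrite PhiE subr_ge0 in PhiG.
have pos : 0 < 1 - (collisions G)%:R / (4 * Delta%:R ^+ 2) :> R.
  rewrite ltNge; apply/negP => neg.
  have := lt_le_trans (mulr_gt0 w3 mwZ) PhiG; apply/negP; rewrite -leNgt.
  by rewrite mulr_le0_ge0// mulr_ge0_le0// ltW// mulr_gt0.
have few : (collisions G <= 4 * Delta ^ 2)%N.
  rewrite ltnW// -(ltr_nat R) natrM natrX; move: pos.
  by rewrite subr_gt0 ltr_pdivrMr ?mul1r// mulr_gt0.
have mwG : w ^+ 3 * (\sum_x mw G x) <= 2 * C * (\sum_x mw G x * S x).
  apply: le_trans PhiG _; apply: ler_wpM2r => //.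
  by rewrite (ger_pMr _ C20) gerBl divr_ge0// mulr_ge0// ltW.
have mwE x : mw G x = q ^+ (\sum_t disagree (G t) x.1 x.2).
  by rewrite /mw /matching_weight -(big_morph _ (exprD q) (expr0 q)).
(* Dropping repeated edges can only raise a weight, and by [hi] it does so by at most the factor
   [q^(- 4 Delta^2)]. *)
have lo x : mw G x <= q ^+ graph_disagree G x.1 x.2.
  rewrite mwE; apply: ler_wiXn2l; rewrite ?(ltW q_gt0)//.
  by have /andP[] := graph_disagree_bounds G x.1 x.2.
have hi x : q ^+ (4 * Delta ^ 2) * q ^+ graph_disagree G x.1 x.2 <= mw G x.
  rewrite mwE -exprD; apply: ler_wiXn2l; rewrite ?(ltW q_gt0)//.
  have /andP[_ h] := graph_disagree_bounds G x.1 x.2.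
  by apply: leq_trans h _; rewrite addnC leq_add2r.
apply: le_trans (_ : \sum_x mw G x * S x <= _); last first.
  by apply: ler_sum => x _; rewrite ler_wpM2r.
have -> : 16 * (1 + (shift_const R Delta)^-1) = 2 * C by rewrite /C; ring.
rewrite mulrAC ler_pdivrMr// [leRHS]mulrC; apply: le_trans mwG.
rewrite -mulrA ler_wpM2l ?(ltW w3)// mulr_sumr.
by apply: ler_sum => x _; exact: hi.
Qed.

End Annealed.

(** * The Rayleigh quotient of a symmetric matrix *)

Section SymmetricSpectrum.
Local Open Scope sesquilinear_scope.

(** In an orthonormal eigenbasis over [R[i]] the Rayleigh quotient is a weighted mean of the
    eigenvalues, so it cannot exceed all of them. *)
Lemma symmetric_rayleigh_le_eigenvalue (R : rcfType) (N : nat) (M : 'M[R]_N) : M^T = M ->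
  exists r : 'I_N -> R, (forall j, eigenvalue M (r j)) /\
    forall v : 'cV[R]_N, v != 0 ->
      exists j, (v^T *m M *m v) 0 0 <= r j * (v^T *m v) 0 0.
Proof.
move=> Msym; pose iota : {rmorphism R -> R[i]} := real_complex R; pose A := map_mx iota M.
have Asym : A \is symmetricmx.
  apply/is_hermitianmxP; rewrite expr0 scale1r; apply/matrixP => i j.
  by rewrite !mxE -{1}Msym mxE.
have iota_real x : iota x \is Num.real by apply/complex_realP; exists x.
have Areal : A \is a realmx by apply/mxOverP => i j; rewrite mxE.
have Aherm := realsym_hermsym Asym Areal.
set P := spectralmx A; set d := spectral_diag A.
have AE : A = invmx P *m diag_mx d *m P by apply/orthomx_spectralP/hermitian_normalmx.
have Punit : P \in unitmx := spectral_unit A.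
have Pinv : invmx P = P^t* := invmx_unitary (spectral_unitarymx A).
pose r j := complex.Re (d 0 j).
have dE j : d 0 j = iota (r j).
  have /mxOverP/(_ 0 j) := hermitian_spectral_diag_real Aherm.
  by move=> dr; rewrite /r /iota /= RRe_real.
exists r; split=> [j|v v0].
  (* Eigenvalues descend from [R[i]] to [R] as roots of the characteristic polynomial. *)
  suff : eigenvalue A (d 0 j) by rewrite dE !eigenvalue_root_char -map_char_poly fmorph_root.
  apply/eigenvalueP; exists (row j P).
    rewrite -row_mul AE !mulmxA mulmxV// mul1mx.
    by apply/rowP => k; rewrite !mxE (bigD1 j)//= big1 ?addr0 ?mxE ?eqxx ?mulr1n//;
      move=> i ij; rewrite mxE eq_sym (negPf ij) mul0r.
  apply/negP => /eqP rowP0; have := congr1 (row j) (mulmxV Punit).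
  rewrite row_mul rowP0 mul0mx => /rowP/(_ j); rewrite !mxE eqxx => /eqP.
  by rewrite eq_sym oner_eq0.
pose u : 'rV[R[i]]_N := map_mx iota v^T; pose y := u *m invmx P.
have conjv : u^t* = map_mx iota v.
  by apply/matrixP => i j; rewrite !mxE conj_Creal.
have yC : y^t* = P *m map_mx iota v.
  rewrite /y trmx_mul map_mxM conjv Pinv.
  by congr (_ *m _); rewrite -map_trmx trmxK -map_mx_comp map_mx_id// => x; exact: conjCK.
have E1 : iota ((v^T *m M *m v) 0 0) = \sum_j iota (r j) * `|y 0 j| ^+ 2.
  have -> : iota ((v^T *m M *m v) 0 0) = (y *m diag_mx d *m y^t*) 0 0.
    transitivity ((map_mx iota (v^T *m M *m v)) 0 0); first by rewrite [RHS]mxE.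
    by rewrite !map_mxM -/A -/u yC /y AE !mulmxA.
  rewrite mxE; apply: eq_bigr => j _; rewrite mul_mx_diag !mxE dE.
  by rewrite mulrC mulrA normCKC mulrC.
have E2 : iota ((v^T *m v) 0 0) = \sum_j `|y 0 j| ^+ 2.
  have -> : iota ((v^T *m v) 0 0) = (y *m y^t*) 0 0.
    transitivity ((map_mx iota (v^T *m v)) 0 0); first by rewrite [RHS]mxE.
    by rewrite !map_mxM -/u yC /y mulmxA mulmxKV.
  by rewrite mxE; apply: eq_bigr => j _; rewrite !mxE normCK.
have [//|H] := pselect (exists j, (v^T *m M *m v) 0 0 <= r j * (v^T *m v) 0 0).
exfalso; move/forallNP : H => H.
set a := (v^T *m M *m v) 0 0 in E1 H; set b := (v^T *m v) 0 0 in E2 H.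
have vpos : 0 < b.
  rewrite /b mxE lt0r; apply/andP; split; last first.
    by apply: sumr_ge0 => i _; rewrite mxE -expr2 sqr_ge0.
  apply: contra v0 => /eqP S0; apply/eqP/colP => i; rewrite mxE.
  have /psumr_eq0P : forall i : 'I_N, true -> 0 <= v^T 0 i * v i 0.
    by move=> k _; rewrite mxE -expr2 sqr_ge0.
  by move=> /(_ S0 i erefl)/eqP; rewrite mxE -expr2 sqrf_eq0 => /eqP.
have : \sum_j (iota a - iota (r j * b)) * `|y 0 j| ^+ 2 = 0.
  under eq_bigr do rewrite mulrBl rmorphM mulrAC.
  by rewrite sumrB -mulr_sumr -mulr_suml -E2 -E1 subrr.
have pos j : 0 < iota a - iota (r j * b).
  by rewrite subr_gt0 ltcR ltNge; apply/negP/H.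
move/psumr_eq0P => y0.
have {}y0 j : `|y 0 j| ^+ 2 = 0.
  have := y0 (fun i _ => mulr_ge0 (ltW (pos i)) (exprn_ge0 2 (normr_ge0 _))) j erefl.
  by move/eqP; rewrite mulf_eq0 (gt_eqF (pos j)) => /eqP.
by move: E2; rewrite big1// => /eqP; rewrite fmorph_eq0 gt_eqF.
Qed.

End SymmetricSpectrum.

Lemma rayleigh_le_lambda_max (R : realType) (N : nat) (M : 'M[R]_N) (v : 'cV[R]_N) :
  M^T = M -> 0 < (v^T *m v) 0 0 -> qform M v / (v^T *m v) 0 0 <= lambda_max M.
Proof.
move=> Msym v0; have [r [rM rv]] := symmetric_rayleigh_le_eigenvalue Msym.
have vn0 : v != 0 by apply: contraTneq v0 => ->; rewrite mulmx0 mxE ltxx.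
have [j vj] := rv _ vn0.
apply: le_trans (_ : r j <= _); first by rewrite ler_pdivrMr.
apply: ub_le_sup; last exact: rM.
(* The supremum needs a bounded set: the Rayleigh bound at an eigenvector puts each eigenvalue below
   some [r i]. *)
exists (\sum_i `|r i|) => a /= /eigenvalueP[x xM x0].
have x0' : x^T != 0 by rewrite -trmx0 (inj_eq trmx_inj).
have [i xi] := rv _ x0'; move: xi; rewrite trmxK xM -scalemxAl mxE.
have xpos : 0 < (x *m x^T) 0 0.
  rewrite mxE lt0r; apply/andP; split; last first.
    by apply: sumr_ge0 => k _; rewrite mxE -expr2 sqr_ge0.
  apply: contra x0 => /eqP S0; apply/eqP/rowP => k; rewrite mxE.
  have /psumr_eq0P H : forall k : 'I_N, true -> 0 <= x 0 k * x^T k 0.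
    by move=> l _; rewrite mxE -expr2 sqr_ge0.
  by move: (H S0 k erefl) => /eqP; rewrite mxE -expr2 sqrf_eq0 => /eqP.
rewrite ler_pM2r// => ari; apply: le_trans ari (le_trans (ler_norm _) _).
by rewrite (bigD1 i)//= lerDl sumr_ge0.
Qed.

(** * The Ising model on a bipartite graph *)

Section FlipSymmetric.
Variables (R : realType) (N : nat) (mu : config N -> R).
Let flip (x : config N) : config N := [ffun i => ~~ x i].
Hypotheses (mu_flip : forall x, mu (flip x) = mu x) (mu_sum : \sum_x mu x = 1).

Let flipK : involutive flip.
Proof. by move=> x; apply/ffunP => i; rewrite !ffunE negbK. Qed.

Definition correlation_mx : 'M[R]_N :=
  \matrix_(i, j) \sum_x mu x * (spin R (x i) * spin R (x j)).

Lemma sum_flip (f : config N -> R) : \sum_x mu x * f x = \sum_x mu x * f (flip x).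
Proof. by rewrite (reindex_inj (inv_inj flipK)); apply: eq_bigr => x _; rewrite mu_flip. Qed.

Lemma mean_spin_flip i : mean_spin mu i = 0.
Proof.
have E : mean_spin mu i = - mean_spin mu i.
  rewrite {1}/mean_spin sum_flip /mean_spin -sumrN; apply: eq_bigr => x _.
  by rewrite ffunE /spin; case: (x i); rewrite /= ?mulrN ?opprK.
by lra.
Qed.

Lemma prob_spin b i : prob mu (fun x : config N => x i == b) = 1 / 2.
Proof.
have E : prob mu (fun x : config N => x i == b) = prob mu (fun x : config N => x i != b).
  rewrite /prob [LHS](reindex_inj (inv_inj flipK)); apply: eq_big => x.
    by rewrite ffunE; case: (x i); case: b.
  by rewrite mu_flip.
have : prob mu (fun x : config N => x i == b) + prob mu (fun x : config N => x i != b) = 1.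
  by rewrite -mu_sum (bigID (fun x : config N => x i == b)).
lra.
Qed.

(** All means are [0] and both spin values have probability [1/2], so an influence is twice a
    difference of joint probabilities; the flip makes this the expected product of spins. *)
Lemma influence_mx_flip : influence_mx mu = correlation_mx.
Proof.
apply/matrixP => i j; rewrite !mxE mean_spin_flip ltr01 oppr_lt0 ltr01 /=.
rewrite /cond_prob !prob_spin.
have pE b c : prob mu (predI (fun x : config N => x j == b) (fun x : config N => x i == c)) =
    \sum_x mu x * ((x j == b) && (x i == c))%:R.
  rewrite /prob big_mkcond; apply: eq_bigr => x _ /=.
  by case: (_ && _); rewrite ?mulr1 ?mulr0.
rewrite !pE.
have -> : \sum_x mu x * (spin R (x i) * spin R (x j)) =
    (\sum_x mu x * ((x j == true) && (x i == true))%:R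
     - \sum_x mu x * ((x j == true) && (x i == false))%:R) +
    (\sum_x mu x * ((x j == false) && (x i == false))%:R
     - \sum_x mu x * ((x j == false) && (x i == true))%:R).
  rewrite -!sumrB -big_split; apply: eq_bigr => x _ /=.
  by rewrite /spin; case: (x i); case: (x j) => /=; ring.
have fE b c : \sum_x mu x * ((x j == b) && (x i == c))%:R =
    \sum_x mu x * ((x j == ~~ b) && (x i == ~~ c))%:R.
  rewrite sum_flip; apply: eq_bigr => x _; rewrite !ffunE.
  by case: (x i); case: (x j); case: b; case: c.
by rewrite (fE false false) (fE false true) /=; field.
Qed.

Lemma qform_correlation_mx (v : 'cV[R]_N) :
  qform correlation_mx v = \sum_x mu x * (\sum_i v i 0 * spin R (x i)) ^+ 2.
Proof.
rewrite /qform mxE.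
under eq_bigr do rewrite mxE mulr_suml.
under eq_bigr do under eq_bigr do rewrite !mxE mulr_sumr mulr_suml.
under eq_bigr do rewrite exchange_big /=.
rewrite exchange_big /=; apply: eq_bigr => x _.
rewrite expr2 mulr_suml mulr_sumr; apply: eq_bigr => i _.
rewrite mulr_sumr mulr_sumr; apply: eq_bigr => j _; ring.
Qed.

End FlipSymmetric.

Section BipartiteIsing.
Variables (R : realType) (n : nat) (E : rel 'I_n).

Definition bip_rel : rel 'I_(n + n) := fun u v =>
  match fintype.split u, fintype.split v with
  | inl i, inr j => E i j
  | inr j, inl i => E i j
  | _, _ => false
  end.

Definition left_side : {set 'I_(n + n)} := [set lshift n i | i : 'I_n].
Definition right_side : {set 'I_(n + n)} := [set rshift n i | i : 'I_n].

Lemma split_lshift (i : 'I_n) : fintype.split (lshift n i) = inl i.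
Proof. exact: (unsplitK (inl i)). Qed.

Lemma split_rshift (i : 'I_n) : fintype.split (rshift n i) = inr i.
Proof. exact: (unsplitK (inr i)). Qed.

Lemma lshift_left_side i : lshift n i \in left_side.
Proof. exact: imset_f. Qed.

Lemma rshift_left_side i : (rshift n i \in left_side) = false.
Proof. by apply/negP => /imsetP[j _ /eqP]; rewrite eq_rlshift. Qed.

Lemma bip_rel_simple : simple_graph bip_rel.
Proof.
split=> [u v|u]; rewrite /bip_rel; case: (fintype.split u) => // i; by case: (fintype.split v).
Qed.

Lemma bip_rel_bipartition : bipartition left_side right_side bip_rel.
Proof.
have L (v : 'I_(n + n)) : v \in left_side \/ v \in right_side.
  by case: (split_ordP v) => i ->; [left|right]; exact: imset_f.
split=> //.
  apply/pred0P => v /=; apply/negP => /andP[/imsetP[i _ ->] /imsetP[j _ /eqP]].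
  by rewrite eq_lrshift.
move=> u v; case: (split_ordP u) => i ->; case: (split_ordP v) => j ->;
  rewrite /bip_rel ?split_lshift ?split_rshift // => _; [left|right]; by split; exact: imset_f.
Qed.

Lemma card_left_side : #|left_side| = n.
Proof. by rewrite card_imset ?card_ord//; exact: lshift_inj. Qed.

Lemma card_right_side : #|right_side| = n.
Proof. by rewrite card_imset ?card_ord//; exact: rshift_inj. Qed.

Lemma bip_rel_max_degree (D : nat) :
  (forall i, #|[set j | E i j]| <= D)%N -> (forall j, #|[set i | E i j]| <= D)%N ->
  (max_degree bip_rel <= D)%N.
Proof.
move=> HL HR; apply/bigmax_leqP => v _; case: (split_ordP v) => i ->.
  apply: leq_trans (HL i); rewrite -(card_imset _ (@rshift_inj n n)).
  apply/subset_leq_card/fintype.subsetP => u; rewrite inE.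
  case: (split_ordP u) => j ->; rewrite /bip_rel ?split_lshift ?split_rshift // => Eij.
  by apply/imsetP; exists j; rewrite ?inE.
apply: leq_trans (HR i); rewrite -(card_imset _ (@lshift_inj n n)).
apply/subset_leq_card/fintype.subsetP => u; rewrite inE.
case: (split_ordP u) => j ->; rewrite /bip_rel ?split_lshift ?split_rshift // => Eij.
by apply/imsetP; exists j; rewrite ?inE.
Qed.

(* The right side is flipped, so that equal spins across an edge count as
   disagreement. *)
Definition plus_left (x : config (n + n)) : {set 'I_n} := [set i | x (lshift n i)].
Definition minus_right (x : config (n + n)) : {set 'I_n} := [set i | ~~ x (rshift n i)].

Definition edge_disagree (A B : {set 'I_n}) : nat :=
  #|[set p : 'I_n * 'I_n | E p.1 p.2 && ((p.1 \in A) != (p.2 \in B))]|.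

Lemma sum_config (f : {set 'I_n} -> {set 'I_n} -> R) :
  \sum_x f (plus_left x) (minus_right x) = \sum_(p : {set 'I_n} * {set 'I_n}) f p.1 p.2.
Proof.
pose h (p : {set 'I_n} * {set 'I_n}) : config (n + n) :=
  [ffun u => match fintype.split u with inl i => i \in p.1 | inr j => j \notin p.2 end].
rewrite (reindex h) /=.
  apply: eq_bigr => -[A B] _ /=; congr f; apply/setP => i; rewrite !inE ffunE.
    by rewrite split_lshift.
  by rewrite split_rshift negbK.
exists (fun x => (plus_left x, minus_right x)) => [[A B] _|x _].
  by congr pair; apply/setP => i; rewrite !inE ffunE ?split_lshift ?split_rshift ?negbK.
apply/ffunP => u; rewrite ffunE; case: (split_ordP u) => i ->.
  by rewrite inE.
by rewrite inE negbK.
Qed.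

Lemma side_vec_dot (x : config (n + n)) :
  \sum_u side_vec R left_side u 0 * spin R (x u) =
  2 * (#|plus_left x|%:R + #|minus_right x|%:R - n%:R).
Proof.
have cardE (A : {set 'I_n}) (b : 'I_n -> bool) : (forall i, (i \in A) = b i) ->
    \sum_i spin R (b i) = 2 * #|A|%:R - n%:R.
  move=> bE; have -> : n%:R = \sum_(i < n) (1 : R) by rewrite sumr_const card_ord.
  rewrite -sum1_card natr_sum mulr_sumr [X in X - _]big_mkcond -sumrB.
  by apply: eq_bigr => i _; rewrite bE /spin; case: (b i); ring.
rewrite big_split_ord /=.
under eq_bigr do rewrite mxE lshift_left_side mul1r.
under [X in _ + X]eq_bigr do rewrite mxE rshift_left_side.
rewrite (cardE (plus_left x)) => [|i]; last by rewrite inE.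
have -> : \sum_(i < n) -1 * spin R (x (rshift n i)) = \sum_(i < n) spin R (~~ x (rshift n i)).
  by apply: eq_bigr => i _; rewrite /spin; case: (x _) => /=; ring.
rewrite (cardE (minus_right x)) => [|i]; last by rewrite inE.
ring.
Qed.

Lemma side_vec_norm : ((side_vec R left_side)^T *m side_vec R left_side) 0 0 = 2 * n%:R.
Proof.
rewrite mxE (eq_bigr (fun=> 1)) => [|u _].
  by rewrite sumr_const card_ord natrD; ring.
by rewrite !mxE; case: ifP => _; ring.
Qed.

(** The factor [1/2] undoes the double count of edges. After the flip each edge contributes [beta_c]
    to the exponent, less [2 beta_c] if it disagrees, and
    [exp (- 2 beta_c) = (Delta - 2) / Delta]. *)
Lemma ising_weight_bip (Delta : nat) (x : config (n + n)) : (3 <= Delta)%N ->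
  ising_weight bip_rel (- beta_c R Delta) x =
  expR (beta_c R Delta * #|[set p : 'I_n * 'I_n | E p.1 p.2]|%:R) *
  ((Delta%:R - 2) / Delta%:R) ^+ edge_disagree (plus_left x) (minus_right x).
Proof.
move=> D3; have D3R : 3 <= Delta%:R :> R by rewrite ler_nat.
set b := beta_c R Delta.
have qE : (Delta%:R - 2) / Delta%:R = expR (- (2 * b)) :> R.
  rewrite /b /beta_c [2 * _]mulrC divfK ?pnatr_eq0// expRN lnK ?invf_div//.
  by rewrite posrE divr_gt0//; lra.
rewrite qE -expRM_natl -expRD /ising_weight; congr expR.
pose xi i := spin R (x (lshift n i)); pose yj j := spin R (x (rshift n j)).
have -> : qform (adjacency_mx R bip_rel) (spin_vec R x) =
    2 * \sum_(p : 'I_n * 'I_n) (E p.1 p.2)%:R * (xi p.1 * yj p.2).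
  rewrite /qform mxE.
  under eq_bigr do rewrite mxE mulr_suml.
  under eq_bigr do under eq_bigr do rewrite !mxE.
  rewrite big_split_ord /=.
  under eq_bigr do rewrite big_split_ord /=.
  under [X in _ + X]eq_bigr do rewrite big_split_ord /=.
  have z1 (i j : 'I_n) : bip_rel (lshift n i) (lshift n j) = false.
    by rewrite /bip_rel !split_lshift.
  have z2 (i j : 'I_n) : bip_rel (rshift n i) (rshift n j) = false.
    by rewrite /bip_rel !split_rshift.
  have z3 (i j : 'I_n) : bip_rel (lshift n i) (rshift n j) = E i j.
    by rewrite /bip_rel split_lshift split_rshift.
  have z4 (i j : 'I_n) : bip_rel (rshift n j) (lshift n i) = E i j.
    by rewrite /bip_rel split_lshift split_rshift.
  have -> : \sum_(p : 'I_n * 'I_n) (E p.1 p.2)%:R * (xi p.1 * yj p.2) =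
      \sum_i \sum_j (E i j)%:R * (xi i * yj j).
    by rewrite (pair_bigA _ (fun i j => (E i j)%:R * (xi i * yj j))).
  have -> : 2 * (\sum_i \sum_j (E i j)%:R * (xi i * yj j)) =
     \sum_j \sum_i (E i j)%:R * (xi i * yj j) + \sum_i \sum_j (E i j)%:R * (xi i * yj j).
    by rewrite [X in X + _]exchange_big /=; ring.
  rewrite [RHS]addrC; congr (_ + _).
    apply: eq_bigr => i _; rewrite big1 => [|j _]; last by rewrite z1 mulr0 mul0r.
    by rewrite add0r; apply: eq_bigr => j _; rewrite z4 /xi /yj; ring.
  apply: eq_bigr => j _; rewrite [X in _ + X]big1 => [|i _]; last by rewrite z2 mulr0 mul0r.
  by rewrite addr0; apply: eq_bigr => i _; rewrite z3 /xi /yj; ring.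
have cE (P : pred ('I_n * 'I_n)) : #|[set p | P p]|%:R = \sum_p (P p)%:R :> R.
  rewrite -sum1_card natr_sum big_mkcond; apply: eq_bigr => p _.
  by rewrite inE; case: (P p).
rewrite /edge_disagree !cE mulr_suml !mulr_sumr -big_split; apply: eq_bigr => p _.
rewrite !inE /xi /yj /spin; case: (E _ _) => /=; last by ring.
by case: (x _); case: (x _) => /=; field.
Qed.

Lemma ising_weight_flip (N : nat) (e : rel 'I_N) (beta : R) (x : config N) :
  ising_weight e beta [ffun i => ~~ x i] = ising_weight e beta x.
Proof.
rewrite /ising_weight; congr (expR (_ * _)); rewrite /qform.
have -> : spin_vec R [ffun i => ~~ x i] = - spin_vec R x.
  by apply/colP => i; rewrite !mxE ffunE /spin; case: (x i); rewrite //= opprK.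
by rewrite mulmxN [(- _)^T]linearN /= !mulNmx opprK.
Qed.

Lemma partition_function_gt0 (N : nat) (e : rel 'I_N) (beta : R) :
  0 < partition_function e beta.
Proof.
rewrite /partition_function (bigD1 [ffun=> true]) //=; apply: ltr_pwDl; first exact: expR_gt0.
by apply: sumr_ge0 => x _; exact: expR_ge0.
Qed.

Lemma influence_mx_ising (N : nat) (e : rel 'I_N) (beta : R) :
  influence_mx (ising_gibbs e beta) = correlation_mx (ising_gibbs e beta).
Proof.
apply: influence_mx_flip => [x|]; first by rewrite /ising_gibbs ising_weight_flip.
by rewrite /ising_gibbs -mulr_suml divff// lt0r_neq0// partition_function_gt0.
Qed.

(** The constant [K] cancels against the partition function, and [4] is the square of the factor in
    [side_vec_dot]. *)
Lemma qform_influence_bip (Delta : nat) : (3 <= Delta)%N ->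
  let q : R := (Delta%:R - 2) / Delta%:R in
  qform (influence_mx (ising_gibbs bip_rel (- beta_c R Delta))) (side_vec R left_side) =
  4 * (\sum_(p : {set 'I_n} * {set 'I_n})
         q ^+ edge_disagree p.1 p.2 * (#|p.1|%:R + #|p.2|%:R - n%:R) ^+ 2) /
  \sum_(p : {set 'I_n} * {set 'I_n}) q ^+ edge_disagree p.1 p.2.
Proof.
move=> D3 q; rewrite influence_mx_ising qform_correlation_mx.
pose K := expR (beta_c R Delta * #|[set p : 'I_n * 'I_n | E p.1 p.2]|%:R).
have K0 : K != 0 by rewrite lt0r_neq0// expR_gt0.
have D3R : 3 <= Delta%:R :> R by rewrite ler_nat.
have q0 : 0 < q by rewrite /q divr_gt0//; lra.
rewrite -(sum_config (fun A B => q ^+ edge_disagree A B * (#|A|%:R + #|B|%:R - n%:R) ^+ 2)).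
rewrite -(sum_config (fun A B => q ^+ edge_disagree A B)).
have ZE : partition_function bip_rel (- beta_c R Delta) =
    K * \sum_x q ^+ edge_disagree (plus_left x) (minus_right x).
  by rewrite mulr_sumr; apply: eq_bigr => x _; rewrite ising_weight_bip.
rewrite mulrAC mulr_sumr; apply: eq_bigr => x _.
rewrite /ising_gibbs ZE ising_weight_bip// -/K -/q side_vec_dot.
have S0 : \sum_x q ^+ edge_disagree (plus_left x) (minus_right x) != 0.
  have := partition_function_gt0 bip_rel (- beta_c R Delta).
  by rewrite ZE; apply: contraTneq => ->; rewrite mulr0 ltxx.
by field; rewrite S0.
Qed.

End BipartiteIsing.

Lemma matching_graph_degree (n Delta : nat) (G : {ffun 'I_Delta -> 'S_n}) :
  (forall i, #|[set j | [exists t, G t i == j]]| <= Delta)%N /\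
  (forall j, #|[set i | [exists t, G t i == j]]| <= Delta)%N.
Proof.
have D (f : 'I_Delta -> 'I_n) (A : {set 'I_n}) :
    (forall i, i \in A -> exists t, f t = i) -> (#|A| <= Delta)%N.
  move=> fA; rewrite -[X in (_ <= X)%N]card_ord -cardsT.
  apply: leq_trans (leq_imset_card f _); apply/subset_leq_card/fintype.subsetP => i /fA[t <-].
  exact: imset_f.
split=> i.
  by apply: (D (fun t => G t i)) => j; rewrite inE => /existsP[t /eqP]; exists t.
apply: (D (fun t => ((G t)^-1)%g i)) => j; rewrite inE => /existsP[t /eqP <-].
by exists t; rewrite permK.
Qed.

Theorem theorem5p2 (R : realType) (Delta : nat) (hDelta : (3 <= Delta)%N) :
  exists c : R, 0 < c /\
  forall n : nat, (1 <= n)%N ->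
  exists (VL VR : {set 'I_(n + n)}) (e : rel 'I_(n + n)),
    [/\ simple_graph e, bipartition VL VR e,
        #|VL| = n, #|VR| = n & (max_degree e <= Delta)%N] /\
    let Psi := influence_mx (ising_gibbs e (- beta_c R Delta)) in
    let s := side_vec R VL in
    [/\ qform Psi s / (s^T *m s) 0 0 <= lambda_max Psi,
        qform Psi s / (s^T *m s) 0 0 = qform Psi s / (2 * n%:R)
      & c * Num.sqrt n%:R <= qform Psi s / (2 * n%:R)].
Proof.
pose q : R := (Delta%:R - 2) / Delta%:R.
have q0 : 0 < q.
  have : 3 <= Delta%:R :> R by rewrite ler_nat.
  by move=> ?; rewrite /q divr_gt0//; lra.
pose C : R := 16 * (1 + (shift_const R Delta)^-1).
have C0 : 0 < C.
  have : 0 < shift_const R Delta by rewrite /shift_const divr_gt0 ?expR_gt0 ?exprn_gt0.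
  by rewrite -invr_gt0 /C => ?; rewrite mulr_gt0// addr_gt0.
(* [M] bounds every [n] with [sqrt n < 40^2], the range outside the asymptotic argument; [c2] is the
   constant for these [n]. *)
pose M := Num.bound ((40 ^+ 2) ^+ 2 : R).
pose c1 := q ^+ (4 * Delta ^ 2) / C; pose c2 : R := (4 ^+ M)^-1.
have c10 : 0 < c1 by rewrite divr_gt0// exprn_gt0.
have c20 : 0 < c2 by rewrite invr_gt0 exprn_gt0.
exists (Num.min c1 c2); split; first by rewrite lt_min c10.
move=> n n1; have n0 : 0 < n%:R :> R by rewrite ltr0n.
pose S (p : {set 'I_n} * {set 'I_n}) : R := (#|p.1|%:R + #|p.2|%:R - n%:R) ^+ 2.
suff [E [dE [dE' bound]]] : exists E : rel 'I_n,
    (forall i, #|[set j | E i j]| <= Delta)%N /\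
    (forall j, #|[set i | E i j]| <= Delta)%N /\
    Num.min c1 c2 * Num.sqrt n%:R * n%:R * (\sum_p q ^+ edge_disagree E p.1 p.2) <=
    2 * (\sum_p q ^+ edge_disagree E p.1 p.2 * S p).
  exists (left_side n), (right_side n), (bip_rel E); split.
    split; [exact: bip_rel_simple|exact: bip_rel_bipartition|exact: card_left_side|
      exact: card_right_side|exact: bip_rel_max_degree].
  move=> Psi s; rewrite /s side_vec_norm; split=> //.
    rewrite -(side_vec_norm R n); apply: rayleigh_le_lambda_max.
      rewrite /Psi influence_mx_ising; apply/matrixP => i j; rewrite !mxE.
      by apply: eq_bigr => x _; rewrite [spin _ _ * _]mulrC.
    by rewrite side_vec_norm mulr_gt0.
  rewrite qform_influence_bip// -/q -/(S _).
  have Z0 : 0 < \sum_(p : {set 'I_n} * {set 'I_n}) q ^+ edge_disagree E p.1 p.2.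
    rewrite (bigD1 (set0, set0))//=; apply: ltr_pwDl; first exact: exprn_gt0.
    by apply: sumr_ge0 => p _; rewrite exprn_ge0// ltW.
  rewrite ler_pdivlMr ?mulr_gt0// ler_pdivlMr//.
  move: bound; rewrite /S; lra.
have sqn : Num.sqrt n%:R ^+ 2 = n%:R :> R by rewrite sqr_sqrtr// ltW.
have [wbig|wsmall] := leP (40 ^+ 2) (Num.sqrt n%:R : R).
  have [G HG] := exists_matchings_second_moment hDelta wbig (esym sqn).
  have [d1 d2] := matching_graph_degree G.
  exists (fun i j => [exists t, G t i == j]); split=> //; split=> //.
  rewrite /edge_disagree -!/(graph_disagree G _ _).
  set X := \sum_p _ in HG *; set Y := \sum_p _ * S p.
  have X0 : 0 <= X by apply: sumr_ge0 => p _; rewrite exprn_ge0// ltW.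
  have {}HG : Num.sqrt n%:R ^+ 3 * c1 * X <= Y by rewrite /c1 mulrA.
  have Y0 : 0 <= Y.
    by apply: sumr_ge0 => p _; rewrite mulr_ge0 ?sqr_ge0// exprn_ge0// ltW.
  apply: le_trans (_ : Y <= _); last by lra.
  apply: le_trans HG; rewrite ler_wpM2r// -{2}sqn -mulrA -exprS mulrC.
  by rewrite ler_wpM2l ?exprn_ge0 ?sqrtr_ge0// ge_min lexx.
(* For small [n] the empty graph serves: all [4^n] pairs have weight [1], the full pair alone
   contributes [n^2] to the second moment, and [c2 * 4 ^+ n <= 1]. *)
exists (fun _ _ => false); split; first by move=> i; rewrite cardsE card0.
split; first by move=> i; rewrite cardsE card0.
have d0 A B : edge_disagree (fun _ _ : 'I_n => false) A B = 0%N.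
  by rewrite /edge_disagree cardsE card0.
under eq_bigr do rewrite d0 expr0.
under [X in _ <= _ * X]eq_bigr do rewrite d0 expr0 mul1r.
rewrite sumr_const card_prod -!cardsT -powersetT card_powerset cardsT card_ord -expnMn.
have sq0 : 0 <= Num.sqrt n%:R :> R := sqrtr_ge0 _.
have SX : n%:R ^+ 2 <= \sum_p S p.
  rewrite (bigD1 (setT, setT)) //= {1}/S /= cardsT card_ord addrK lerDl.
  by apply: sumr_ge0 => p _; exact: sqr_ge0.
have nM : (n <= M)%N.
  rewrite ltnW// -(ltr_nat R); apply: le_lt_trans (archi_boundP _); last by rewrite !exprn_ge0.
  by rewrite -sqn ler_sqr ?nnegrE ?exprn_ge0// ltW.
have sn : Num.sqrt n%:R <= n%:R :> R.
  rewrite -[leRHS]sqn expr2 ler_peMr// -[leLHS]sqrtr1 ler_sqrt//.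
  by rewrite ler1n.
have c2n : c2 * 4 ^+ n <= 1.
  by rewrite /c2 mulrC ler_pdivrMr ?exprn_gt0// mul1r ler_eXn2l// ltr1n.
have cmin : Num.min c1 c2 <= c2 by rewrite ge_min lexx orbT.
have cmin0 : 0 <= Num.min c1 c2 by rewrite ltW// lt_min c10.
rewrite natrX -[(2 * 2)%N]/4%N.
apply: le_trans (_ : (n%:R * n%:R) * (c2 * 4 ^+ n) <= _).
  have -> : Num.min c1 c2 * Num.sqrt n%:R * n%:R * 4 ^+ n =
    (Num.sqrt n%:R * n%:R) * (Num.min c1 c2 * 4 ^+ n) by ring.
  apply: ler_pM; rewrite ?mulr_ge0 ?exprn_ge0 ?(ltW n0)//; last by rewrite ler_wpM2r ?exprn_ge0.
  by rewrite ler_wpM2r// ltW.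
have nn : 0 <= n%:R * n%:R :> R by rewrite mulr_ge0// ltW.
have := ler_wpM2l nn c2n; lra.
Qed.
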